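(* Let $G$ be a discrete Cayley graph, $\mathcal P$ a spin model on its vertex set $V$ and $\xi$ a score function such that one of the following two conditions holds: 1. $G$ is $b$-amenable; $\mathcal P$ is a clustering spin model whose clustering function $\phi$ is summable in $G$; and $\xi$ is a local score function. 2. $G$ has polynomial growth; $\mathcal P$ is an exponentially clustering spin model; $\xi$ is an exponentially quasi-local score function on $\mathcal P$ satisfying the exponential growth condition, and $(\xi,\mathcal P)$ satisfies the $p$-moment condition for some $p>2$. Let $H_n^\xi=\sum_{x\in\mathcal P_n}\xi(x,\mathcal P_n)$. Then as $n\to\infty$, $$w_n^{-1}\operatorname{Var}(H_n^\xi)\to\sigma^2(\xi,\mathcal P):=\sum_{z\in V}\operatorname{Cov}\bigl(\xi(O,\mathcal P),\xi(z,\mathcal P)\bigr)\in[0,\infty),$$ and further $$w_n^{-1}H_n^\xi\ \xrightarrow{\ P\ }\ \mathbb E(\xi(O,\mathcal P))\in\mathbb R$$ (convergence in probability).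
   Context: **Cayley graphs.** $(V,+)$ is a countably infinite group (not necessarily commutative) with identity $O$, generated by a finite symmetric set $S$ ($h\in S\iff -h\in S$) with $O\notin S$. The discrete Cayley graph $G=(V,E)$ has $(g_1,g_2)\in E$ iff $-g_1+g_2\in S$. $d$ is the graph distance, $|x|=d(O,x)$, so $d(x,y)=|-x+y|$; $d(A,B)=\min_{x\in A,y\in B}d(x,y)$. $W_r(x)=\{y:d(x,y)\le r\}$, $W_r=W_r(O)$, $W_\infty=V$, $w_n=|W_n|$. $\partial A=\{x\in A:\exists y\notin A,\ (x,y)\in E\}$. $G$ is $b$-amenable if $|\partial W_n|/|W_n|\to0$ as $n\to\infty$; $G$ has polynomial growth if $|W_n|=O(n^{d_2})$ for some $d_2>0$. **Spin models.** $\mathcal N=\{0,1\}^V$; $\mu\in\mathcal N$ is identified with the subset $\{x:\mu_x=1\}$ of $V$. A spin model is an $\mathcal N$-valued random variable $\mathcal P$; $\mathcal P_n=\mathcal P\cap W_n$, $\mathcal P_\infty=\mathcal P$. $\mathcal P$ is stationary if $y+\mathcal P\stackrel d=\mathcal P$ for all $y\in V$, non-degenerate if $\mathbb P(O\in\mathcal P)\in(0,1)$. A function $\phi:[0,\infty)\to[0,\infty)$ is fast decreasing if $\phi\le1$, $\phi$ is decreasing and $\lim_{s\to\infty}s^m\phi(s)=0$ for all $m\ge1$. A stationary non-degenerate $\mathcal P$ is a clustering spin model if there are constants $C_k,c_k\in(0,\infty)$ ($C_k$ non-decreasing, $c_k$ non-increasing in $k$) and a fast decreasing $\phi$ (the clustering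 function) such that for all $p,q\ge1$ and distinct $x_1,\dots,x_{p+q}\in V$, $$|\mathbb P(\{x_1,\dots,x_{p+q}\}\subset\mathcal P)-\mathbb P(\{x_1,\dots,x_p\}\subset\mathcal P)\mathbb P(\{x_{p+1},\dots,x_{p+q}\}\subset\mathcal P)|\le C_{p+q}\phi(c_{p+q}s),$$ $s=d(\{x_1,\dots,x_p\},\{x_{p+1},\dots,x_{p+q}\})$. It is exponentially clustering if moreover $c_k\ge c>0$ for all $k$, $C_k=O(k^{ak})$ for some $a\in[0,1)$ and $\limsup_{t\to\infty}\log\phi(t)/t^b<0$ for some $b\in(0,\infty)$. A fast decreasing $\phi$ is summable in $G$ if $\sum_{x\in V}\phi^{1/p}(c|x|)<\infty$ for all $c>0$, $p\ge1$. **Score functions.** A score function is a measurable $\xi:V\times\mathcal N\to\mathbb R$ that is translation-invariant, $\xi(y+x,y+\mu)=\xi(x,\mu)$, with the convention $\xi(x,\mu)=0$ if $x\notin\mu$. It is local if there is $r>0$ such that $\xi(O,\mu)$ depends only on $\mu\cap W_r$ for every $\mu$. The radius of stabilisation is $R(O,\mu)=\inf\{r>0,\ r\in\mathbb N:\xi(O,\mu)=\xi(O,\mu')\ \forall\mu'\in\mathcal N\text{ with }\mu'\cap W_r=\mu\cap W_r\}$ and $R(x,\mu)=R(O,-x+\mu)$. $\xi$ is exponentially quasi-local on $\mathcal P$ if there are $A>0$ and a function $\varphi(t)\downarrow0$ with $\sup_{1\le n\le\infty}\sup_{x\in W_n}\mathbb P(R(x,\mathcal P_n)\ge t)\le A\varphi(t)$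 for all $t$ and $\limsup_{t\to\infty}\log\varphi(t)/t^c<0$ for some $c\in(0,\infty)$. Exponential growth condition: for some $\kappa\in[0,\infty)$ and constant $c_*<\infty$, $|\xi(O,\mu\cap W_t)|\le e^{c_*t^\kappa}$ for all $t>0$, $\mu\in\mathcal N$. $p$-moment condition: $\sup_{1\le n\le\infty}\sup_{x\in W_n}\mathbb E(\max\{|\xi(x,\mathcal P_n)|,1\}^p)<\infty$. *)

(* Defs.v *)
From HB Require Import structures.
From mathcomp Require Import all_boot all_order all_algebra finmap.
From mathcomp Require Import all_classical all_reals all_analysis.

Set Implicit Arguments.
Unset Strict Implicit.
Unset Printing Implicit Defensive.
Import Order.TTheory GRing.Theory Num.Theory.
Import numFieldNormedType.Exports.

Local Open Scope classical_set_scope.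
Local Open Scope ring_scope.

(* Possibly non-commutative groups are MathComp's [groupType], which is written
   multiplicatively: the identity O is 1, x + y is x * y, - x is x^-1. *)

Definition generates (V : groupType) (S : set V) : Prop :=
  forall H : set V,
    H 1%g -> (forall x y, H x -> H y -> H (x * y^-1)%g) -> S `<=` H ->
    H = setT.

Definition cayley_generators (V : groupType) (S : set V) : Prop :=
  [/\ finite_set S, (forall h, S h <-> S (h^-1)%g), ~ S 1%g & generates S].

Definition adj (V : groupType) (S : set V) : rel V :=
  fun x y => `[< S (x^-1 * y)%g >].

(* The least element of a set of naturals; 0 by convention on the empty set. *)
Definition nat_min (A : set nat) : nat :=
  xget 0%N [set n | A n /\ forall m, A m -> (n <= m)%N].

(* [x :: p] is a walk from [x] to [y] with [size p] edges. *)
Definition gdist (V : groupType) (S : set V) (x y : V) : nat :=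
  nat_min [set n | exists p : seq V,
    [/\ path (adj S) x p, last x p = y & size p = n]].

Definition glen (V : groupType) (S : set V) (x : V) : nat := gdist S 1%g x.

Definition set_gdist (V : groupType) (S : set V) (A B : set V) : nat :=
  nat_min [set gdist S x y | x in A & y in B].

Definition gball (V : groupType) (S : set V) (R : realType) (x : V) (r : R) :
    set V :=
  [set y | (gdist S x y)%:R <= r].

(* W_n for 1 <= n <= oo, with [None] encoding n = oo. *)
Definition window (R : realType) (V : groupType) (S : set V) (n : option nat) :
    set V :=
  if n is Some m then gball S 1%g (m%:R : R) else setT.

Definition window_index : set (option nat) :=
  [set n | if n is Some m then (1 <= m)%N else True].

(* [fset_set A] is empty when A is infinite; balls are finite as S is. *)
Definition card (V : groupType) (A : set V) : nat := #|` fset_set A|.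

Definition vol (R : realType) (V : groupType) (S : set V) (n : nat) : nat :=
  card (window R S (Some n)).

Definition boundary (V : groupType) (S : set V) (A : set V) : set V :=
  [set x | A x /\ exists y, ~ A y /\ adj S x y].

Definition b_amenable (R : realType) (V : groupType) (S : set V) : Prop :=
  ((card (boundary S (window R S (Some n))))%:R / (vol R S n)%:R : R)
    @[n --> \oo] --> (0 : R).

Definition polynomial_growth (R : realType) (V : groupType) (S : set V) :
    Prop :=
  exists d2 : R, 0 < d2 /\
    (fun n : nat => (vol R S n)%:R : R) =O_\oo (fun n : nat => n%:R `^ d2).

(* {0,1}^V, identified with the subsets of V, with the product sigma-algebra. *)
Definition coordinate_events (V : groupType) : set (set (set V)) :=
  [set [set mu : set V | mu x] | x in [set: V]].

Notation config V := (g_sigma_algebraType (@coordinate_events V)).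

Definition translate (V : groupType) (y : V) (mu : set V) : set V :=
  [set (y * x)%g | x in mu].

(* The random set P_n = P `&` W_n, with P_oo = P. *)
Definition restrict_spin (R : realType) (V : groupType) (S : set V) (T : Type)
    (X : T -> set V) (n : option nat) (w : T) : set V :=
  X w `&` window R S n.

Definition stationary (V : groupType) d (T : measurableType d) (R : realType)
    (P : probability T R) (X : T -> config V) : Prop :=
  forall (y : V) (A : set (config V)), measurable A ->
    pushforward P ((translate y : config V -> config V) \o X) A
    = pushforward P X A.

Definition non_degenerate (V : groupType) d (T : measurableType d)
    (R : realType) (P : probability T R) (X : T -> config V) : Prop :=
  (0 < P [set w | X w 1%g] < 1)%E.

(* Functions on [0, oo) are functions R -> R constrained only on [0, oo);
   decreasing means non-increasing. *)
Definition fast_decreasing (R : realType) (phi : R -> R) : Prop :=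
  [/\ forall s, 0 <= s -> 0 <= phi s <= 1,
      forall s t, 0 <= s -> s <= t -> phi t <= phi s
    & forall m : nat, (1 <= m)%N -> s ^+ m * phi s @[s --> +oo] --> (0 : R)].

Definition clustering (V : groupType) (S : set V) d (T : measurableType d)
    (R : realType) (P : probability T R) (X : T -> config V)
    (C c : nat -> R) (phi : R -> R) : Prop :=
  [/\ stationary P X /\ non_degenerate P X,
      (forall k, 0 < C k) /\ (forall k l, (k <= l)%N -> C k <= C l),
      (forall k, 0 < c k) /\ (forall k l, (k <= l)%N -> c l <= c k),
      fast_decreasing phi
    & forall xs ys : seq V, (1 <= size xs)%N -> (1 <= size ys)%N ->
      uniq (xs ++ ys) ->
      let k := (size xs + size ys)%N in
      let s := (set_gdist S [set` xs] [set` ys])%:R in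
      (`| P [set w | [set` xs ++ ys] `<=` X w]
          - P [set w | [set` xs] `<=` X w] * P [set w | [set` ys] `<=` X w] |
        <= (C k * phi (c k * s))%:E)%E].

(* limsup_(t -> +oo) log (f t) / t^b < 0, with log 0 = -oo. *)
Definition stretched_exp_decay (R : realType) (f : R -> R) (b : R) : Prop :=
  (limf_esup (fun t : R => lne (f t)%:E * ((t `^ b)^-1)%:E) (pinfty_nbhs R)
    < 0)%E.

Definition exponentially_clustering (V : groupType) (S : set V) d
    (T : measurableType d) (R : realType) (P : probability T R)
    (X : T -> config V) : Prop :=
  exists (C c : nat -> R) (phi : R -> R),
    [/\ clustering S P X C c phi,
        exists c0 : R, 0 < c0 /\ forall k, c0 <= c k,
        exists a : R, 0 <= a < 1 /\
          C =O_\oo (fun k : nat => k%:R `^ (a * k%:R))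
      & exists b : R, 0 < b /\ stretched_exp_decay phi b].

Definition summable_in (V : groupType) (S : set V) (R : realType)
    (phi : R -> R) : Prop :=
  forall c p : R, 0 < c -> 1 <= p ->
    (\esum_(x in [set: V]) (phi (c * (glen S x)%:R) `^ p^-1)%:E < +oo)%E.

(* Copy of V, pointed as [g_sigma_algebraType] requires. *)
Definition vertices (V : groupType) : Type := V.
HB.instance Definition _ (V : groupType) := Choice.on (vertices V).
HB.instance Definition _ (V : groupType) :=
  isPointed.Build (vertices V) (1%g : V).

Notation discrete V := (g_sigma_algebraType [set: set (vertices V)]).

Definition score_function (V : groupType) (R : realType)
    (xi : V -> set V -> R) : Prop :=
  [/\ measurable_fun setT
        (fun z : discrete V * config V => xi z.1 z.2),
      forall y x mu, xi (y * x)%g (translate y mu) = xi x mu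
    & forall x mu, ~ mu x -> xi x mu = 0].

Definition local_score (V : groupType) (S : set V) (R : realType)
    (xi : V -> set V -> R) : Prop :=
  exists r : R, 0 < r /\ forall mu mu' : set V,
    mu `&` gball S 1%g r = mu' `&` gball S 1%g r -> xi 1%g mu = xi 1%g mu'.

(* R(O, mu), equal to +oo when no radius stabilises. *)
Definition stab_radius0 (V : groupType) (S : set V) (R : realType)
    (xi : V -> set V -> R) (mu : set V) : \bar R :=
  ereal_inf [set (r%:R : R)%:E | r in [set r : nat | (0 < r)%N /\
    forall mu' : set V,
      mu' `&` gball S 1%g (r%:R : R) = mu `&` gball S 1%g (r%:R : R) ->
      xi 1%g mu = xi 1%g mu']].

Definition stab_radius (V : groupType) (S : set V) (R : realType)
    (xi : V -> set V -> R) (x : V) (mu : set V) : \bar R :=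
  stab_radius0 S xi (translate (x^-1)%g mu).

(* sup_(1 <= n <= oo) sup_(x in W_n) F n x. *)
Definition sup_windows (R : realType) (V : groupType) (S : set V)
    (F : option nat -> V -> \bar R) : \bar R :=
  ereal_sup [set ereal_sup [set F n x | x in window R S n]
            | n in window_index].

Definition exp_quasi_local (V : groupType) (S : set V) d
    (T : measurableType d) (R : realType) (P : probability T R)
    (X : T -> config V) (xi : V -> set V -> R) : Prop :=
  exists (A : R) (f : R -> R),
    [/\ 0 < A,
        (forall s t, 0 <= s -> s <= t -> f t <= f s)
          /\ f t @[t --> +oo] --> (0 : R),
        forall t : R, 0 <= t ->
          (sup_windows S (fun n x =>
             P [set w | t%:E <= stab_radius S xi x (restrict_spin R S X n w)])
           <= (A * f t)%:E)%E
      & exists c : R, 0 < c /\ stretched_exp_decay f c].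

Definition exponential_growth (V : groupType) (S : set V) (R : realType)
    (xi : V -> set V -> R) : Prop :=
  exists kappa cstar : R, 0 <= kappa /\ forall (t : R) (mu : set V), 0 < t ->
    `|xi 1%g (mu `&` gball S 1%g t)| <= expR (cstar * t `^ kappa).

Definition moment_condition (V : groupType) (S : set V) d
    (T : measurableType d) (R : realType) (P : probability T R)
    (X : T -> config V) (xi : V -> set V -> R) (p : R) : Prop :=
  (sup_windows S (fun n x =>
     'E_P[(fun w => Num.max `|xi x (restrict_spin R S X n w)| 1 `^ p)%R])
   < +oo)%E.

(* H_n; the sum is finite as W_n is. *)
Definition score_sum (V : groupType) (S : set V) (R : realType) (T : Type)
    (X : T -> set V) (xi : V -> set V -> R) (n : nat) (w : T) : R :=
  let Xn := restrict_spin R S X (Some n) w in \sum_(x \in Xn) xi x Xn.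

(* The value of an unordered infinite sum, meaningful for [summable] families. *)
Definition signed_sum (V : groupType) (R : realType) (f : V -> \bar R) :
    \bar R :=
  (\esum_(z in [set: V]) f^\+ z - \esum_(z in [set: V]) f^\- z)%E.

Definition score_cov (V : groupType) d (T : measurableType d) (R : realType)
    (P : probability T R) (X : T -> set V) (xi : V -> set V -> R) (z : V) :
    \bar R :=
  covariance P (fun w => xi 1%g (X w)) (fun w => xi z (X w)).

Definition sigma2 (V : groupType) d (T : measurableType d) (R : realType)
    (P : probability T R) (X : T -> set V) (xi : V -> set V -> R) : \bar R :=
  signed_sum (score_cov P X xi).

Definition cvg_in_probability d (T : measurableType d) (R : realType)
    (P : probability T R) (Y : nat -> T -> R) (l : R) : Prop :=
  forall e : R, 0 < e ->
    P [set w | e < `|Y n w - l|] @[n --> \oo] --> (0 : \bar R)%E.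

(* Main.v *)
Require Import Defs.
From HB Require Import structures.
From mathcomp Require Import all_boot all_order all_algebra finmap.
From mathcomp Require Import all_classical all_reals all_analysis.
From mathcomp Require Import measurable_realfun zify ring lra.

Set Implicit Arguments.
Unset Strict Implicit.
Unset Printing Implicit Defensive.
Import Order.TTheory GRing.Theory Num.Theory.
Import numFieldNormedType.Exports.

Local Open Scope classical_set_scope.
Local Open Scope ring_scope.

(* Write xi_n(x) for the score of x in P_n. The variance of H_n is the sum of
   Cov(xi_n(x), xi_n(y)) over x, y in W_n. If these covariances are dominated by
   a summable function of d(x, y), and agree up to a small error with those of
   the infinite system when x and y are far from the boundary, then amenability
   makes the points near the boundary negligible, each remaining row sum is
   close to sigma^2, and the weak law follows by Chebyshev's inequality.

   For the domination, xi_n(x) is replaced by its restriction to the event that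
   the radius of stabilisation is at most r. This is a bounded function of the
   spins in W_r(x), hence a combination of indicators of {A is contained in P}
   with A in W_r(x), and clustering bounds its covariances. In the local case r
   is constant; in the exponential case r is a small power of d(x, y), and the
   truncation error is controlled by the moment condition.

   Amenability under polynomial growth needs no structure theory of groups:
   |W_6k| <= Q |W_k| holds at infinitely many scales k, at each of which the
   annulus of width 4k inside W_n is larger than the annulus of width k by a
   fixed factor, so that the outermost sphere is a vanishing part of W_n. *)

(** * Word metric and balls *)

(** The choice of truncation radius is forced from two sides. Expanding a function of the spins in
    an r-ball into inclusion indicators costs a factor [3 ^+ w_r], exponential in the volume of the
    ball; stretched exponential clustering at distance s pays for it only if w_r is polynomial in r
    and r is at most a q-th root of s with q large. In return, a truncation error that is stretched
    exponential in r remains stretched exponential in s, hence summable against polynomial volume.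
    Quasi-locality controls only the probability of instability, while the covariance estimate needs
    the second moment of the score on that event; a moment of order p > 2 converts the one into the
    other. Scores in a finite window are not stationary. Stationarity is used for the infinite
    window alone, and finite windows are compared with it at points far from the boundary. For the
    same reason the mean of H_n / w_n is not the limiting mean, and Chebyshev's inequality carries a
    bias term. *)

Lemma nat_minP (A : set nat) : A !=set0 ->
  A (nat_min A) /\ forall m, A m -> (nat_min A <= m)%N.
Proof.
move=> [n An]; rewrite /nat_min.
have exA : exists n, `[< A n >] by exists n; exact/asboolP.
case: (ex_minnP exA) => m /asboolP Am mmin.
apply: (@xgetPex _ _ [set n | A n /\ forall m, A m -> (n <= m)%N]); exists m.
by split => // k Ak; apply: mmin; apply/asboolP.
Qed.

Section word_metric.
Variables (V : groupType) (S : set V).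
Hypothesis S_gen : cayley_generators S.
Local Open Scope group_scope.

Lemma adj_sym : symmetric (adj S).
Proof.
move=> x y; case: S_gen => _ sS _ _.
by apply: asbool_equiv_eq; rewrite sS invgM invgK.
Qed.

Lemma adj_mul g x y : adj S (g * x) (g * y) = adj S x y.
Proof. by rewrite /adj invgM -mulgA mulKg. Qed.

Lemma path_mul g x p :
  path (adj S) (g * x) (map (fun z => g * z) p) = path (adj S) x p.
Proof. by elim: p x => //= y p IH x; rewrite adj_mul IH. Qed.

Lemma path_adj_rev x p : path (adj S) x p ->
  path (adj S) (last x p) (rev (belast x p)).
Proof.
rewrite rev_path; congr (is_true (path _ x p)).
by apply/funext => a; apply/funext => b; rewrite adj_sym.
Qed.

(** The end points of walks from 1 satisfy the closure condition in [generates]: for x * y^-1, the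
    reversed walk from y to 1 is translated on the left by x * y^-1, so that it starts at x, and is
    appended to a walk from 1 to x. *)
Lemma walk_from1 x : exists p, path (adj S) 1 p /\ last 1 p = x.
Proof.
case: S_gen => _ _ _ /(_ [set x | exists p, path (adj S) 1 p /\ last 1 p = x]).
move=> H; suff: [set x | exists p, path (adj S) 1 p /\ last 1 p = x] x by [].
rewrite H //=.
- by exists [::].
- move=> _ y [p [pp <-]] [q [qq yE]].
  have /(path_adj_rev) := qq; rewrite yE -(path_mul (last 1 p * y^-1)) mulgVK => qp.
  exists (p ++ map (fun z => last 1 p * y^-1 * z) (rev (belast 1 q))).
  rewrite cat_path pp qp last_cat; split => //.
  case: q {qq qp} yE => [<-/=|z q yE /=]; first by rewrite invg1 mulg1.
  by rewrite rev_cons map_rcons last_rcons mulg1.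
- move=> s Ss; exists [:: s]; split => //=; rewrite andbT.
  by apply/asboolP; rewrite invg1 mul1g.
Qed.

(** Connectedness makes the set of walk lengths nonempty, so the default value 0 of [nat_min] does
    not interfere and the minimum is attained. *)
Lemma gdistP x y : exists p,
  [/\ path (adj S) x p, last x p = y & size p = gdist S x y].
Proof.
rewrite /gdist; set A := [set n | _].
have [|//] := @nat_minP A.
have [p [pp pl]] := walk_from1 (x^-1 * y).
exists (size p), (map (fun z => x * z) p); split; last by rewrite size_map.
  by have := pp; rewrite -(path_mul x) mulg1.
by have := last_map (fun z => x * z) p 1; rewrite mulg1 => ->; rewrite pl mulVKg.
Qed.

Lemma gdist_le x p : path (adj S) x p -> (gdist S x (last x p) <= size p)%N.
Proof.
move=> pp; rewrite /gdist; set A := [set n | _].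
have Ap : A (size p) by exists p.
by have [|_] := @nat_minP A; [exists (size p)|apply].
Qed.

Lemma gdist_mul g x y : gdist S (g * x) (g * y) = gdist S x y.
Proof.
have le h u v : (gdist S (h * u) (h * v) <= gdist S u v)%N.
  have [p [pp <- <-]] := gdistP u v; rewrite -(size_map (fun z => h * z)).
  by rewrite -(last_map (fun z => h * z)) gdist_le // path_mul.
apply/eqP; rewrite eqn_leq le /=.
by have := le g^-1 (g * x) (g * y); rewrite !mulKg.
Qed.

Lemma gdistE x y : gdist S x y = glen S (x^-1 * y).
Proof. by rewrite /glen -(gdist_mul x^-1) mulVg. Qed.

Lemma gdist_sym x y : gdist S x y = gdist S y x.
Proof.
have le u v : (gdist S u v <= gdist S v u)%N.
  have [p [pp <- <-]] := gdistP v u; rewrite -(size_belast v p) -size_rev.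
  have := gdist_le (path_adj_rev pp).
  by congr (gdist S _ _ <= _)%N; case: p {pp} => //= z p; rewrite rev_cons last_rcons.
by apply/eqP; rewrite eqn_leq !le.
Qed.

Lemma gdist_triangle y x z : (gdist S x z <= gdist S x y + gdist S y z)%N.
Proof.
have [p [pp <- <-]] := gdistP x y; have [q [qq <- <-]] := gdistP (last x p) z.
by rewrite -size_cat -last_cat gdist_le // cat_path pp.
Qed.

Lemma gdistxx x : gdist S x x = 0%N.
Proof. by apply/eqP; rewrite -leqn0; apply: (@gdist_le x [::]). Qed.

Lemma gdist0 x y : gdist S x y = 0%N -> x = y.
Proof. by have [p [_ <- <-]] := gdistP x y; case: p. Qed.

Lemma glen1 : glen S 1 = 0%N. Proof. exact: gdistxx. Qed.

Lemma gdist_adj x y : adj S x y -> (gdist S x y <= 1)%N.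
Proof. by move=> xy; apply: (@gdist_le x [:: y]); rewrite /= xy. Qed.

Lemma gdist_geodesic x y k : (k <= gdist S x y)%N ->
  exists z, gdist S x z = k /\ gdist S z y = (gdist S x y - k)%N.
Proof.
have [p [pp pl ps]] := gdistP x y; rewrite -ps => kp.
have ppE := pp; rewrite -(cat_take_drop k p) cat_path in ppE.
have /andP[p1 p2] := ppE.
set z := last x (take k p) in p2.
have le1 : (gdist S x z <= k)%N.
  by have := gdist_le p1; rewrite size_takel.
have le2 : (gdist S z y <= size p - k)%N.
  by have := gdist_le p2; rewrite size_drop /z -last_cat cat_take_drop pl.
exists z; have := gdist_triangle z x y; rewrite -ps; lia.
Qed.

(** The last step of a shortest walk places a point of length n + 1 in the product of the n-ball and
    the finite set S. *)
Lemma finite_glen_ball n : finite_set [set x | (glen S x <= n)%N].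
Proof.
case: (S_gen) => fS _ _ _.
elim: n => [|n IH].
  apply: (@sub_finite_set _ _ [set 1]); last exact: finite_set1.
  by move=> x /=; rewrite leqn0 => /eqP /gdist0 <-.
apply: (@sub_finite_set _ _ ([set x | (glen S x <= n)%N] `|`
    [set x * y | x in [set x | (glen S x <= n)%N] & y in S])).
  move=> x /= xn; case: (leqP (glen S x) n) => [|nx]; [by left|right].
  have [p [pp pl ps]] := gdistP 1 x.
  have {xn nx} xE : gdist S 1 x = n.+1 by rewrite /glen in xn nx; lia.
  case: (lastP p) pp pl ps => [_ _ /=|q z]; first by rewrite xE.
  rewrite rcons_path last_rcons size_rcons xE => /andP[pq /asboolP zS] zx [qn].
  exists (last 1 q); first by rewrite /= -qn gdist_le.
  by rewrite -zx; exists ((last 1 q)^-1 * z) => //; rewrite mulVKg.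
by rewrite finite_setU; split => //; exact: finite_image2.
Qed.

Definition ball_fset n : {fset V} := fset_set [set x | (glen S x <= n)%N].

Lemma in_ball_fset n x : (x \in ball_fset n) = (glen S x <= n)%N.
Proof.
rewrite in_fset_set; last exact: finite_glen_ball.
by apply/idP/idP; rewrite inE.
Qed.

Lemma windowE (R : realType) n :
  window R S (Some n) = [set x | (glen S x <= n)%N].
Proof. by apply/seteqP; split => x; rewrite /= /gball /= ler_nat. Qed.

Lemma volE (R : realType) n : vol R S n = #|` ball_fset n|.
Proof. by rewrite /vol /card windowE. Qed.

Definition ball_at x n : {fset V} := [fset x * y | y in ball_fset n]%fset.

Lemma in_ball_at x n y : (y \in ball_at x n) = (gdist S x y <= n)%N.
Proof.
apply/imfsetP/idP => [[z /= + ->]|].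
  by rewrite in_ball_fset gdistE mulKg.
by move=> xy; exists (x^-1 * y); rewrite /= ?in_ball_fset -?gdistE ?mulVKg.
Qed.

Lemma card_ball_at x n : #|` ball_at x n| = #|` ball_fset n|.
Proof. by rewrite card_imfset //; apply: mulgI. Qed.

End word_metric.

(** Greedy choice: an element joins the net only if no net point is related to it, which keeps the
    net separated; a rejected element is covered by the point that caused its rejection. *)
Lemma separated_net (T : eqType) (r : rel T) (s : seq T) :
  reflexive r -> symmetric r ->
  exists Z : seq T, [/\ uniq Z, {subset Z <= s},
    {in Z &, forall y z, y != z -> ~~ r y z}
    & {in s, forall x, exists2 z, z \in Z & r z x}].
Proof.
move=> rr rs; elim: s => [|a s [Z [uZ Zs sepZ covZ]]]; first by exists [::].
case: (boolP (has (r^~ a) Z)) => [/hasP[z zZ za]|/hasPn Za].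
  exists Z; split => //; first by move=> y /Zs; rewrite inE orbC => ->.
  by move=> y /predU1P[->|/covZ//]; exists z.
exists (a :: Z); split.
- by rewrite /= uZ andbT; apply/negP => /Za; rewrite rr.
- by move=> y; rewrite !inE => /predU1P[->|/Zs ->]; rewrite ?eqxx ?orbT.
- move=> y z /predU1P[->|yZ] /predU1P[->|zZ]; rewrite ?eqxx // => yz.
  + by rewrite rs Za.
  + exact: Za.
  + exact: sepZ.
- move=> y /predU1P[->|/covZ[z zZ zy]]; first by exists a; rewrite ?mem_head.
  by exists z => //; rewrite inE zZ orbT.
Qed.

Section fset_counting.
Variables (K : choiceType) (I : eqType).

Lemma card_cover_le (A : {fset K}) (Z : seq I) (F : I -> {fset K}) :
  {in A, forall x, exists2 z, z \in Z & x \in F z} ->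
  (#|` A| <= \sum_(z <- Z) #|` F z|)%N.
Proof.
elim: Z A => [|z Z IH] A cov.
  rewrite big_nil leqn0 cardfs_eq0; apply/eqP/fsetP => x; rewrite !inE.
  by apply/negP => /cov[].
rewrite big_cons -(cardfsID (F z) A) leq_add //.
  by rewrite fsubset_leq_card // fsubsetIr.
apply: IH => x; rewrite inE => /andP[xz /cov[y]].
by move=> /predU1P[->|]; [rewrite (negPf xz)|exists y].
Qed.

Lemma card_packing_le (A : {fset K}) (Z : seq I) (F : I -> {fset K}) :
  uniq Z -> {in Z, forall z, (F z `<=` A)%fset} ->
  {in Z &, forall y z, y != z -> [disjoint F y & F z]%fset} ->
  (\sum_(z <- Z) #|` F z| <= #|` A|)%N.
Proof.
elim: Z A => [|z Z IH] A /=; first by rewrite big_nil.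
move=> /andP[zZ uZ] sub dis; rewrite big_cons -(cardfsID (F z) A).
have zh : z \in z :: Z by rewrite mem_head.
have /fsetIidPr -> := sub z zh.
rewrite leq_add2l; apply: IH => //.
  move=> y yZ; have yZ' : y \in z :: Z by rewrite inE yZ orbT.
  rewrite fsubsetD sub //= dis //.
  by apply: contraNneq zZ => <-.
by move=> x y xZ yZ; apply: dis; rewrite inE ?xZ ?yZ orbT.
Qed.

End fset_counting.

(** * Decay of spheres under polynomial growth *)

Section spheres.
Variables (V : groupType) (S : set V).
Hypothesis S_gen : cayley_generators S.

Local Notation B := (ball_fset S).
Local Notation w n := #|` ball_fset S n|.

Lemma sub_ball_fset m n : (m <= n)%N -> (B m `<=` B n)%fset.
Proof.
by move=> mn; apply/fsubsetP => x; rewrite !in_ball_fset // => /leq_trans; apply.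
Qed.

Lemma vol_gt0 n : (0 < w n)%N.
Proof.
by rewrite cardfs_gt0; apply/fset0Pn; exists 1%g; rewrite in_ball_fset // glen1.
Qed.

Definition annulus n k : {fset V} := (B n `\` B (n - k))%fset.

Lemma in_annulus n k x :
  (x \in annulus n k) = ((n - k < glen S x <= n)%N).
Proof. by rewrite inE !in_ball_fset // -ltnNge. Qed.

(* A point of the annulus of width k is moved back by 2k along a geodesic
   to 1; for a 6k-separated net the k-balls around the moved points are
   disjoint and lie in the next part of the annulus. *)
Lemma annulus_growth Q n k : (0 < k)%N -> (4 * k <= n)%N ->
  (w (6 * k) <= Q * w k)%N ->
  (Q.+1 * #|` annulus n k| <= Q * #|` annulus n (4 * k)|)%N.
Proof.
move=> k0 kn wQ.
have [||Z [uZ ZA sepZ covZ]] := @separated_net V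
    (fun x y => gdist S x y <= 6 * k)%N (enum_fset (annulus n k)).
- by move=> x; rewrite gdistxx.
- by move=> x y; rewrite gdist_sym.
have back z : z \in Z -> exists y,
    gdist S z y = (2 * k)%N /\ glen S y = (glen S z - 2 * k)%N.
  move=> /ZA; rewrite in_annulus => /andP[zk zn].
  have [|y [yz yl]] := @gdist_geodesic _ _ S_gen z 1%g (2 * k).
    by rewrite gdist_sym // -/(glen S z); lia.
  by exists y; rewrite yz /glen gdist_sym // yl gdist_sym.
have /choice[b bP] : forall z, exists y, z \in Z ->
    gdist S z y = (2 * k)%N /\ glen S y = (glen S z - 2 * k)%N.
  by move=> z; case: (boolP (z \in Z)) => [/back[y yP]|_]; [exists y|exists 1%g].
have cov : (#|` annulus n k| <= \sum_(z <- Z) #|` ball_at S z (6 * k)|)%N.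
  apply: card_cover_le => x xA; have [z zZ zx] := covZ x xA.
  by exists z; rewrite // in_ball_at.
(* Lengths of z in (n - k, n] become lengths of [b z] in (n - 3k, n - 2k], so the k-ball around
   [b z] stays in (n - 4k, n - k]. If the balls of y and z met, then d(y, z) <= 2k + k + k + 2k =
   6k, against separation. *)
have pack : (\sum_(z <- Z) #|` ball_at S (b z) k|
    <= #|` annulus n (4 * k) `\` annulus n k|)%fset%N.
  apply: card_packing_le => // [z zZ|y z yZ zZ yz].
    apply/fsubsetP => x; rewrite in_ball_at // => bx.
    rewrite inE !in_annulus.
    have [zb bl] := bP z zZ; have := ZA z zZ; rewrite in_annulus => /andP[zk zn].
    have xl : (glen S x <= glen S (b z) + k)%N.
      by apply: leq_trans (gdist_triangle S_gen (b z) _ _) _; rewrite leq_add2l.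
    have lx : (glen S (b z) <= glen S x + k)%N.
      apply: leq_trans (gdist_triangle S_gen x _ _) _.
      by rewrite leq_add2l gdist_sym.
    lia.
  have [yb _] := bP y yZ; have [zb _] := bP z zZ.
  apply/fdisjointP => x; rewrite !in_ball_at // => yx.
  apply/negP => zx; have := sepZ y z yZ zZ yz; rewrite -ltnNge.
  have := gdist_triangle S_gen (b y) y z.
  have := gdist_triangle S_gen x (b y) z.
  have := gdist_triangle S_gen (b z) x z.
  rewrite (gdist_sym S_gen x (b z)) (gdist_sym S_gen (b z) z).
  lia.
have sub : (annulus n k `<=` annulus n (4 * k))%fset.
  by apply/fsubsetP => x; rewrite !in_annulus; lia.
have cE : (#|` annulus n (4 * k)| = #|` annulus n k| +
    #|` (annulus n (4 * k) `\` annulus n k)%fset|)%N.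
  by rewrite -(cardfsID (annulus n k) (annulus n (4 * k))) (fsetIidPr _).
(* What remains is |annulus n k| <= |Z| w_6k <= Q |Z| w_k, and the packing bounds |Z| w_k by the
   size of the difference of the two annuli. *)
rewrite cE mulnDr mulSn addnC leq_add2l.
apply: (leq_trans cov); apply: leq_trans (leq_mul (leqnn Q) pack).
rewrite big_distrr /= leq_sum // => z _.
by rewrite !card_ball_at.
Qed.

(** Otherwise each passage from 6^i to 6^(i+1) would multiply the volume by more than 6^(D+1), which
    exceeds polynomial growth of degree D. *)
Lemma doubling_scales C D i0 :
  (forall n, (0 < n)%N -> (w n <= C * n ^ D)%N) ->
  exists2 i, (i0 <= i)%N & (w (6 * 6 ^ i) <= 6 ^ D.+1 * w (6 ^ i))%N.
Proof.
move=> wC; apply: contrapT => /forall2NP noi.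
have grow j : ((6 ^ D.+1) ^ j <= w (6 ^ (i0 + j)))%N.
  elim: j => [|j IH]; first by rewrite expn0 vol_gt0.
  have [|/negP] := noi (i0 + j)%N; first by rewrite leq_addr.
  rewrite -ltnNge => /ltnW h; rewrite addnS !expnS.
  apply: leq_trans h; rewrite leq_mul // -expnS //.
(* After j scales, 6^((D+1) j) <= C 6^(D (i0 + j)), which cancels to 6^j <= C 6^(D i0). This j turns
   it into 6^j <= j, which is absurd. *)
set j := (C * 6 ^ (D * i0))%N.
have := leq_trans (grow j) (wC _ (expn_gt0 6 (i0 + j))).
rewrite -!expnM mulnDl expnD mulSn expnD mulnA [(i0 * D)%N]mulnC -/j.
rewrite [(j * D)%N]mulnC leq_pmul2r ?expn_gt0 // leqNgt ltn_expl //.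
Qed.

(** In fractions: the sphere occupies at most (Q / (Q+1))^J of W_n, with Q = 6^(D+1). Each good
    scale contributes one factor, and J is arbitrary. *)
Lemma sphere_decay C D J :
  (forall n, (0 < n)%N -> (w n <= C * n ^ D)%N) ->
  exists2 N, (0 < N)%N & forall n, (N <= n)%N ->
  ((6 ^ D.+1).+1 ^ J * #|` annulus n 1| <= (6 ^ D.+1) ^ J * w n)%N.
Proof.
move=> wC; set Q := (6 ^ D.+1)%N.
suff [K K0 KP] : exists2 K, (0 < K)%N & forall n, (K <= n)%N ->
    (Q.+1 ^ J * #|` annulus n 1| <= Q ^ J * #|` annulus n K|)%N.
  exists K => // n Kn; apply: leq_trans (KP n Kn) _.
  by rewrite leq_mul // fsubset_leq_card // fsubsetDl.
elim: J => [|J [K K0 IH]]; first by exists 1%N => // n _; rewrite !expn0.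
have [i Ki wi] := doubling_scales K wC.
(* The next good scale is taken beyond the width K already treated, so the annulus of width K lies
   in that of width 6^i, to which [annulus_growth] applies. *)
have Ki6 : (K <= 6 ^ i)%N by apply: leq_trans Ki _; apply/ltnW/ltn_expl.
exists (4 * 6 ^ i)%N => [|n in4]; first by rewrite muln_gt0 expn_gt0.
have := annulus_growth (expn_gt0 6 i) in4 wi.
have := IH n ltac:(lia).
have subA : (#|` annulus n K| <= #|` annulus n (6 ^ i)|)%N.
  by apply/fsubset_leq_card/fsubsetP => x; rewrite !in_annulus; lia.
rewrite -/Q !expnS.
move: (6 ^ i)%N subA => k subA h1 h2.
rewrite -mulnA.
apply: (@leq_trans (Q.+1 * (Q ^ J * #|` annulus n k|))).
  by rewrite leq_mul2l /=; apply: leq_trans h1 _; rewrite leq_mul2l subA orbT.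
by rewrite mulnCA [(Q * Q ^ J)%N]mulnC -mulnA leq_mul2l h2 orbT.
Qed.

End spheres.

Lemma cvg_seqP (R : realType) (u : nat -> R) (l : R) :
  (u n @[n --> \oo] --> l) <->
  forall e, 0 < e -> exists N, forall n, (N <= n)%N -> `|u n - l| <= e.
Proof.
split=> [/cvgrPdist_le ul e e0|h].
  by have [N _ NP] := ul e e0; exists N => n /NP; rewrite /= distrC.
apply/cvgrPdist_le => e e0; have [N NP] := h e e0.
by exists N => // n /= /NP; rewrite distrC.
Qed.

Lemma eqO_bound (R : realType) (u v : nat -> R) :
  u =O_\oo v -> exists C : R, exists N : nat, 0 < C /\
    forall n, (N <= n)%N -> `|u n| <= C * `|v n|.
Proof. by move=> /eqO_exP[C C0 [N _ NP]]; exists C, N; split => // n /NP. Qed.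

(** * Boundaries of balls and amenability *)

Section boundaries.
Variables (R : realType) (V : groupType) (S : set V).
Hypothesis S_gen : cayley_generators S.

Local Notation B := (ball_fset S).
Local Notation w n := #|` ball_fset S n|.

Definition bdry n : {fset V} := fset_set (boundary S [set x | (glen S x <= n)%N]).

Lemma in_bdry n x : (x \in bdry n) =
  `[< (glen S x <= n)%N /\ exists y, (n < glen S y)%N /\ adj S x y >].
Proof.
rewrite in_fset_set; last first.
  by apply: (sub_finite_set _ (finite_glen_ball S_gen n)) => y [].
apply/idP/asboolP; rewrite inE.
  by move=> [xn [y [/negP]]]; rewrite -ltnNge => yn xy; split => //; exists y.
by move=> [xn [y [yn xy]]]; split => //; exists y; split => //; apply/negP; rewrite -ltnNge.
Qed.

Lemma card_boundaryE n : Defs.card (boundary S (window R S (Some n))) = #|` bdry n|.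
Proof. by rewrite /Defs.card windowE. Qed.

Definition nondeep n m : {fset V} :=
  [fset x in B n | ~~ (ball_at S x m `<=` B n)%fset]%fset.

Lemma walk_crosses (p : seq V) x n : (glen S x <= n)%N -> path (adj S) x p ->
  (n < glen S (last x p))%N ->
  exists2 b, b \in bdry n & (gdist S x b <= size p)%N.
Proof.
elim: p x => [|y p IH] x /= xn; first by rewrite ltnNge xn.
move=> /andP[xy yp] pn; case: (leqP (glen S y) n) => yn.
  have [b bb yb] := IH y yn yp pn; exists b => //.
  apply: leq_trans (gdist_triangle S_gen y _ _) _.
  by rewrite -add1n leq_add // gdist_adj.
exists x; last by rewrite gdistxx.
by rewrite in_bdry; apply/asboolP; split => //; exists y.
Qed.

(** A walk of length at most m leading out of W_n passes through the boundary, so the m-balls around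
    boundary points cover all points that are not deep. *)
Lemma card_nondeep n m : (#|` nondeep n m| <= w m * #|` bdry n|)%N.
Proof.
apply: (@leq_trans (\sum_(b <- bdry n) #|` ball_at S b m|)).
  apply: card_cover_le => x; rewrite !inE /= => /andP[xn /fsubsetPn[y]].
  rewrite in_ball_at // !in_ball_fset // -ltnNge => xy yn.
  have [p [pp pl ps]] := gdistP S_gen x y.
  rewrite in_ball_fset // in xn.
  have [|b bb xb] := walk_crosses xn pp; first by rewrite pl.
  exists b => //; rewrite in_ball_at // gdist_sym //.
  by apply: leq_trans xb _; rewrite ps.
rewrite (eq_bigr (fun=> w m)) => [|b _]; last exact: card_ball_at.
by rewrite big_const_seq count_predT iter_addn_0.
Qed.

Lemma b_amenable_nondeep m : b_amenable R S ->
  forall e : R, 0 < e -> exists N, forall n, (N <= n)%N ->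
    (#|` nondeep n m|)%:R <= e * (w n)%:R.
Proof.
move=> /cvg_seqP am e e0.
have wm0 : 0 < (w m)%:R :> R by rewrite ltr0n vol_gt0.
have [|N NP] := am (e / (w m)%:R); first by rewrite divr_gt0.
exists N => n /NP; rewrite card_boundaryE volE // subr0 ger0_norm ?divr_ge0 //.
have wn0 : 0 < (w n)%:R :> R by rewrite ltr0n vol_gt0.
rewrite ler_pdivlMr // mulrAC ler_pdivrMr // => h; apply: le_trans h.
by rewrite -natrM ler_nat mulnC card_nondeep.
Qed.

(** For n = 0 truncated subtraction makes the annulus empty, although 1 may be a boundary point. *)
Lemma bdry_sub_annulus n : (0 < n)%N -> (bdry n `<=` annulus S n 1)%fset.
Proof.
move=> n0; apply/fsubsetP => x; rewrite in_bdry => /asboolP[xn [y [yn xy]]].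
rewrite in_annulus // xn andbT.
have := gdist_triangle S_gen x 1%g y; rewrite -!/(glen S _).
by have := gdist_adj xy; lia.
Qed.

Lemma polynomial_growth_nat : polynomial_growth R S ->
  exists C D, forall n, (0 < n)%N -> (w n <= C * n ^ D)%N.
Proof.
move=> [d [d0 /eqO_bound[C [N [C0 NP]]]]].
pose D := (Num.truncn d).+1; pose C' := (Num.truncn C).+1.
(* The summand [w N] takes care of the radii below N, by monotonicity of the volume. *)
exists (C' + w N)%N, D => n n0; case: (leqP N n) => nN; last first.
  rewrite -[leqLHS]mul1n mulnC leq_mul ?expn_gt0 ?n0 //.
  by apply: leq_trans (leq_addl _ _); rewrite fsubset_leq_card // sub_ball_fset // ltnW.
have := NP n nN; rewrite volE // ger0_norm // ger0_norm ?powR_ge0 // => h.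
rewrite mulnDl; apply: leq_trans (leq_addr _ _).
rewrite -(ler_nat R) (le_trans h) // natrM natrX ler_pM ?powR_ge0 ?(ltW C0) //.
  exact/ltW/truncnS_gt.
rewrite -powR_mulrn //; apply: ler_powR; rewrite ?ler1n //.
exact/ltW/truncnS_gt.
Qed.

Lemma polynomial_growth_amenable : polynomial_growth R S -> b_amenable R S.
Proof.
move=> /polynomial_growth_nat[C [D wC]]; apply/cvg_seqP => e e0.
pose Q := (6 ^ D.+1)%N; pose q : R := Q%:R / Q.+1%:R.
have q01 : `|q| < 1 by rewrite ger0_norm ?divr_ge0 // ltr_pdivrMr // mul1r ltr_nat.
have [J JP] := (cvg_seqP _ _).1 (cvg_expr q01) e e0.
have [N N0 NP] := sphere_decay S_gen J wC.
exists N => n Nn; rewrite card_boundaryE volE // subr0 ger0_norm ?divr_ge0 //.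
apply: (@le_trans _ _ (q ^+ J)); last first.
  by apply: le_trans (JP J (leqnn J)); rewrite subr0 ler_norm.
rewrite ler_pdivrMr ?ltr0n ?vol_gt0 // /q expr_div_n mulrAC.
rewrite ler_pdivlMr ?exprn_gt0 // -!natrX -!natrM ler_nat mulnC.
apply: leq_trans (NP n Nn); rewrite leq_mul // fsubset_leq_card //.
by apply: bdry_sub_annulus; lia.
Qed.

End boundaries.

(** * Square integrable functions and covariances *)

Section square_integrable.
Context d (T : measurableType d) (R : realType) (P : probability T R).
Implicit Types f g u v : T -> R.

Definition integ f := P.-integrable setT (EFin \o f).
Definition Ex f : R := (\int[P]_w f w)%R.
Definition square_integ f :=
  measurable_fun setT f /\ integ (fun w => f w ^+ 2).
(** Real-valued, hence open to ring and order reasoning; [covE] identifies it with [covariance] for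
    square integrable functions. *)
Definition Cv f g : R := Ex (fun w => f w * g w) - Ex f * Ex g.

Lemma integ_dom f g : measurable_fun setT f -> integ g ->
  (forall w, `|f w| <= g w) -> integ f.
Proof.
move=> mf ig fg; apply: (le_integrable measurableT _ _ ig).
  exact/measurable_EFinP.
by move=> w _ /=; rewrite lee_fin (le_trans (fg w)) // ler_norm.
Qed.

Lemma integ_cst r : integ (fun=> r).
Proof. exact: finite_measure_integrable_cst. Qed.

Lemma integ_bounded M f : measurable_fun setT f -> (forall w, `|f w| <= M) ->
  integ f.
Proof. by move=> mf fM; apply: (integ_dom mf (integ_cst M)). Qed.

Lemma integD f g : integ f -> integ g -> integ (fun w => f w + g w).
Proof. by move=> fi gi; apply: (integrableD measurableT fi gi). Qed.

Lemma integB f g : integ f -> integ g -> integ (fun w => f w - g w).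
Proof. by move=> fi gi; apply: (integrableB measurableT fi gi). Qed.

Lemma integZ r f : integ f -> integ (fun w => r * f w).
Proof. by move=> fi; apply: (integrableZl measurableT r fi). Qed.

Lemma integ_norm f : integ f -> integ (fun w => `|f w|).
Proof. by move=> fi; apply: (integrable_norm fi). Qed.

Lemma integ_sum (I : Type) (s : seq I) (F : I -> T -> R) :
  (forall i, integ (F i)) -> integ (fun w => \sum_(i <- s) F i w).
Proof.
move=> iF; elim: s => [|i s IH].
  by apply: eq_integrable (integ_cst 0) => // w _ /=; rewrite big_nil.
apply: eq_integrable (integD (iF i) IH) => // w _ /=.
by rewrite big_cons.
Qed.

Lemma Ex_cst r : Ex (fun=> r) = r.
Proof.
rewrite /Ex Rintegral_cst // -[RHS]mulr1; congr (_ * _).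
by rewrite -[RHS]/(fine 1%E); congr fine; exact: probability_setT.
Qed.

Lemma ExD f g : integ f -> integ g -> Ex (fun w => f w + g w) = Ex f + Ex g.
Proof. exact: RintegralD. Qed.

Lemma ExB f g : integ f -> integ g -> Ex (fun w => f w - g w) = Ex f - Ex g.
Proof. exact: RintegralB. Qed.

Lemma ExZ r f : integ f -> Ex (fun w => r * f w) = r * Ex f.
Proof. exact: RintegralZl. Qed.

Lemma eq_Ex f g : f =1 g -> Ex f = Ex g.
Proof. by move=> fg; apply: eq_Rintegral => w _; rewrite fg. Qed.

Lemma Ex_le f g : integ f -> integ g -> (forall w, f w <= g w) -> Ex f <= Ex g.
Proof. by move=> fi gi fg; apply: le_Rintegral. Qed.

Lemma Ex_ge0 f : (forall w, 0 <= f w) -> 0 <= Ex f.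
Proof. by move=> f0; apply: Rintegral_ge0. Qed.

Lemma Ex_norm f : integ f -> `|Ex f| <= Ex (fun w => `|f w|).
Proof. exact: le_normr_Rintegral. Qed.

Lemma Ex_norm_le f g : integ f -> integ g -> (forall w, `|f w| <= g w) ->
  `|Ex f| <= Ex g.
Proof.
move=> fi gi fg; apply: (le_trans (Ex_norm fi)).
exact: (Ex_le (integ_norm fi) gi).
Qed.

Lemma Ex_sum (I : Type) (s : seq I) (F : I -> T -> R) :
  (forall i, integ (F i)) ->
  Ex (fun w => \sum_(i <- s) F i w) = \sum_(i <- s) Ex (F i).
Proof.
move=> iF; elim: s => [|i s IH].
  rewrite big_nil -[RHS](Ex_cst 0); apply: eq_Ex => w; exact: big_nil.
rewrite big_cons -IH -ExD //; last exact: integ_sum.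
by apply: eq_Ex => w; rewrite big_cons.
Qed.

Lemma ExE f : integ f -> (Ex f)%:E = (\int[P]_w (f w)%:E)%E.
Proof. by move=> fi; rewrite /Ex fineK //; apply: integrable_fin_num. Qed.

Lemma expectationE f : integ f -> ('E_P[f] = (Ex f)%:E)%E.
Proof. by move=> fi; rewrite unlock ExE. Qed.

Lemma Ex_indic (A : set T) : measurable A -> Ex \1_A = fine (P A).
Proof. by move=> mA; rewrite /Ex /Rintegral integral_indic // setIT. Qed.

Lemma integ_indic (A : set T) : measurable A -> integ \1_A.
Proof.
move=> mA; apply: (@integ_bounded 1) => [|w]; first exact: measurable_indic.
by rewrite indicE; case: (w \in A); rewrite ?normr1 ?normr0.
Qed.

Lemma square_integ_dom f g : measurable_fun setT f -> square_integ g ->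
  (forall w, `|f w| <= `|g w|) -> square_integ f.
Proof.
move=> mf [mg g2] fg; split => //; apply: (integ_dom _ g2).
  exact: measurable_funX.
by move=> w; rewrite normrX -[leRHS]real_normK ?num_real // ler_pXn2r ?nnegrE.
Qed.

Lemma square_integ_bounded M f : measurable_fun setT f ->
  (forall w, `|f w| <= M) -> square_integ f.
Proof.
move=> mf fM; apply: (@square_integ_dom f (fun=> M)) => // [|w].
  by split => //; exact: integ_cst.
by rewrite (le_trans (fM w)) // ler_norm.
Qed.

Lemma square_integM f g : square_integ f -> square_integ g ->
  integ (fun w => f w * g w).
Proof.
move=> [mf f2] [mg g2]; apply: (integ_dom _ (integD f2 g2)).
  exact: measurable_funM.
move=> w; rewrite normrM.
rewrite -(real_normK (num_real (f w))) -(real_normK (num_real (g w))).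
nra.
Qed.

Lemma square_integ1 : square_integ (fun=> 1).
Proof. by apply: (@square_integ_bounded 1) => // w; rewrite normr1. Qed.

Lemma square_integ_integ f : square_integ f -> integ f.
Proof.
move=> sf; have := square_integM sf square_integ1.
by apply: eq_integrable => // w _ /=; rewrite mulr1.
Qed.

Lemma square_integ_cut f (D : set T) : measurable D -> square_integ f ->
  square_integ (fun w => f w * \1_D w).
Proof.
move=> mD sf; apply: (square_integ_dom _ sf) => [|w].
  by apply: measurable_funM; [case: sf|exact: measurable_indic].
by rewrite indicE; case: (w \in D); rewrite ?mulr1 ?mulr0 ?normr0.
Qed.

Lemma covE f g : square_integ f -> square_integ g ->
  covariance P f g = (Cv f g)%:E.
Proof.
move=> sf sg; have fi := square_integ_integ sf; have gi := square_integ_integ sg.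
have fgi := square_integM sf sg.
rewrite covarianceE ?Lfun1_integrable //.
by rewrite !expectationE.
Qed.

Lemma CvC f g : Cv f g = Cv g f.
Proof. by rewrite /Cv mulrC; congr (_ - _); apply: eq_Ex => w; rewrite mulrC. Qed.

Lemma CvDl f1 f2 g : square_integ f1 -> square_integ f2 -> square_integ g ->
  Cv (fun w => f1 w + f2 w) g = Cv f1 g + Cv f2 g.
Proof.
move=> s1 s2 sg; rewrite /Cv ExD; try exact: square_integ_integ.
rewrite mulrDl opprD addrACA -ExD; try exact: square_integM.
by congr (_ + _); apply: eq_Ex => w; rewrite mulrDl.
Qed.

Lemma Cv_cst_mul r f g : square_integ f -> square_integ g ->
  Cv (fun w => r * f w) g = r * Cv f g.
Proof.
move=> sf sg; rewrite /Cv ExZ; last exact: square_integ_integ.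
rewrite mulrBr mulrA -(ExZ r (square_integM sf sg)).
by congr (_ - _); apply: eq_Ex => w; rewrite mulrA.
Qed.

Lemma square_integD f g : square_integ f -> square_integ g ->
  square_integ (fun w => f w + g w).
Proof.
move=> sf sg; split; first by apply: measurable_funD; [case: sf|case: sg].
apply: eq_integrable (integD (integD sf.2 sg.2) (integZ 2 (square_integM sf sg))) => //.
by move=> w _ /=; congr EFin; ring.
Qed.

Lemma square_integ_sum (I : Type) (s : seq I) (F : I -> T -> R) :
  (forall i, square_integ (F i)) -> square_integ (fun w => \sum_(i <- s) F i w).
Proof.
move=> sF; elim: s => [|i s IH].
  have -> : (fun w => \sum_(i <- [::]) F i w) = (fun=> 0).
    by apply/funext => w; rewrite big_nil.
  by apply: (@square_integ_bounded 0) => // w; rewrite normr0.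
have -> : (fun w => \sum_(j <- i :: s) F j w) = (fun w => F i w + \sum_(j <- s) F j w).
  by apply/funext => w; rewrite big_cons.
exact: square_integD.
Qed.

Lemma Cv_suml (I : Type) (s : seq I) (F : I -> T -> R) g :
  (forall i, square_integ (F i)) -> square_integ g ->
  Cv (fun w => \sum_(i <- s) F i w) g = \sum_(i <- s) Cv (F i) g.
Proof.
move=> sF sg; have iF i := square_integ_integ (sF i).
rewrite /Cv Ex_sum // sumrB mulr_suml -Ex_sum; last first.
  by move=> i; exact: square_integM.
by congr (_ - _); apply: eq_Ex => w; rewrite mulr_suml.
Qed.

Lemma Cv_sum (I : Type) (s : seq I) (F : I -> T -> R) :
  (forall i, square_integ (F i)) ->
  Cv (fun w => \sum_(i <- s) F i w) (fun w => \sum_(i <- s) F i w) =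
  \sum_(i <- s) \sum_(j <- s) Cv (F i) (F j).
Proof.
move=> sF; rewrite Cv_suml //; last exact: square_integ_sum.
apply: eq_bigr => i _; rewrite CvC Cv_suml //.
by apply: eq_bigr => j _; rewrite CvC.
Qed.

Lemma eq_Cv f f' g g' : f =1 f' -> g =1 g' -> Cv f g = Cv f' g'.
Proof. by move=> /funext -> /funext ->. Qed.

(* Dominates both E(|f|; D) and E(f^2; D). *)
Definition mass_on f (D : set T) : R := Ex (fun w => (1 + f w ^+ 2) * \1_D w).

Lemma integ_mass f D : square_integ f -> measurable D ->
  integ (fun w => (1 + f w ^+ 2) * \1_D w).
Proof.
move=> [mf f2] mD; apply: (integ_dom _ (integD (integ_cst 1) f2)).
  apply: measurable_funM; last exact: measurable_indic.
  by apply: measurable_funD => //; exact: measurable_funX.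
move=> w; have h : 0 <= 1 + f w ^+ 2 by rewrite addr_ge0 // sqr_ge0.
by rewrite indicE; case: (w \in D); rewrite ?mulr1 ?mulr0 ?normr0 // ger0_norm.
Qed.

Lemma mass_on_ge0 f D : 0 <= mass_on f D.
Proof.
by apply: Ex_ge0 => w; rewrite mulr_ge0 // addr_ge0 // sqr_ge0.
Qed.

Lemma norm_le_sqr (x : R) : `|x| <= 1 + x ^+ 2.
Proof. rewrite -(real_normK (num_real x)).
by have := sqr_ge0 `|x|; have := sqr_ge0 (`|x| - 1); rewrite !expr2; nra. Qed.

Lemma Ex_le_mass f : square_integ f -> `|Ex f| <= mass_on f setT.
Proof.
move=> sf; apply: Ex_norm_le; [exact: square_integ_integ|exact: integ_mass|].
by move=> w; rewrite indicE in_setT mulr1 norm_le_sqr.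
Qed.

Lemma indic_complement (D : set T) w : \1_(~` D) w = 1 - \1_D w :> R.
Proof. by rewrite !indicE in_setC; case: (w \in D); rewrite ?subr0 ?subrr. Qed.

Lemma Ex_cut f D : square_integ f -> measurable D ->
  `|Ex f - Ex (fun w => f w * \1_(~` D) w)| <= mass_on f D.
Proof.
move=> sf mD; have sf' := square_integ_cut (measurableC mD) sf.
have fi := square_integ_integ sf; have fi' := square_integ_integ sf'.
rewrite -ExB //; apply: Ex_norm_le; [exact: integB|exact: integ_mass|move=> w].
rewrite indic_complement indicE; case: (w \in D).
  by rewrite subrr mulr0 subr0 mulr1 norm_le_sqr.
by rewrite subr0 !mulr1 subrr mulr0 normr0.
Qed.

(** The product is altered on the union of D1 and D2, where |u v| <= (1 + u^2 + 1 + v^2) / 2. This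
    is why the masses of both functions on both events are required, and not only that of u on D1
    and of v on D2. The term 2 K t comes from the product of the means. *)
Lemma Cv_cut u v D1 D2 (t K : R) : square_integ u -> square_integ v ->
  measurable D1 -> measurable D2 ->
  mass_on u D1 <= t -> mass_on v D1 <= t ->
  mass_on u D2 <= t -> mass_on v D2 <= t ->
  mass_on u setT <= K -> mass_on v setT <= K ->
  `|Cv u v - Cv (fun w => u w * \1_(~` D1) w) (fun w => v w * \1_(~` D2) w)|
    <= (2 + 2 * K) * t.
Proof.
move=> su sv m1 m2 u1 v1 u2 v2 uK vK.
set u' := fun w => u w * _; set v' := fun w => v w * _.
have su' : square_integ u' := square_integ_cut (measurableC m1) su.
have sv' : square_integ v' := square_integ_cut (measurableC m2) sv.
have h1 : `|Ex (fun w => u w * v w) - Ex (fun w => u' w * v' w)| <= 2 * t.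
  rewrite -ExB; try exact: square_integM.
  apply: (@le_trans _ _ (2^-1 * (mass_on u D1 + mass_on v D1 + (mass_on u D2 +
    mass_on v D2)))); last by lra.
  have i1 := integD (integ_mass su m1) (integ_mass sv m1).
  have i2 := integD (integ_mass su m2) (integ_mass sv m2).
  rewrite /mass_on -!ExD //; try exact: integ_mass.
  rewrite -ExZ; last exact: integD.
  apply: Ex_norm_le; first by apply: integB; exact: square_integM.
    by apply: integZ; exact: integD.
  move=> w; rewrite /u' /v' !indic_complement !indicE.
  have uv : `|u w * v w| <= 2^-1 * (1 + u w ^+ 2 + (1 + v w ^+ 2)).
    rewrite normrM -(real_normK (num_real (u w))) -(real_normK (num_real (v w))).
    by have := sqr_ge0 (`|u w| - `|v w|); rewrite !expr2; nra.
  have uv0 := le_trans (normr_ge0 _) uv.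
  case: (w \in D1); case: (w \in D2);
    rewrite ?(subr0, mulr1, mulr0, addr0, add0r, subrr, mul0r, normr0) //.
  by apply: (le_trans uv); lra.
have h2 : `|Ex u * Ex v - Ex u' * Ex v'| <= 2 * K * t.
  have -> : Ex u * Ex v - Ex u' * Ex v' =
      (Ex u - Ex u') * Ex v + Ex u' * (Ex v - Ex v') by ring.
  have a1 := le_trans (Ex_cut su m1) u1.
  have a2 := le_trans (Ex_cut sv m2) v2.
  have b1 : `|Ex u'| <= K.
    apply: le_trans uK; apply: Ex_norm_le; [exact: square_integ_integ|exact: integ_mass|].
    move=> w; rewrite [\1_setT _]indicE in_setT mulr1 /u' indicE.
    case: (w \in _); first by rewrite mulr1 norm_le_sqr.
    by rewrite mulr0 normr0 addr_ge0 // sqr_ge0.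
  have b2 := le_trans (Ex_le_mass sv) vK.
  apply: (le_trans (ler_normD _ _)); rewrite !normrM.
  have c1 : `|Ex u - Ex u'| * `|Ex v| <= t * K by rewrite ler_pM.
  have c2 : `|Ex u'| * `|Ex v - Ex v'| <= K * t by rewrite ler_pM.
  lra.
have -> : Cv u v - Cv u' v' =
  (Ex (fun w => u w * v w) - Ex (fun w => u' w * v' w)) - (Ex u * Ex v - Ex u' * Ex v').
  by rewrite /Cv; ring.
apply: (le_trans (ler_normB _ _)); lra.
Qed.

End square_integrable.

(** * Covariance of local functions *)

Section local_functions.
Context (V : groupType) d (T : measurableType d) (R : realType)
  (P : probability T R) (X : T -> config V).
Hypothesis mX : measurable_fun setT X.

Definition local_on (us : seq V) (f : set V -> R) : Prop :=
  forall mu mu' : set V, (forall u, u \in us -> (mu u <-> mu' u)) -> f mu = f mu'.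

Definition incl_event (xs : seq V) : set T := [set w | [set` xs] `<=` X w].

Lemma measurable_coordinate x : measurable [set mu : config V | mu x].
Proof. by apply: sub_sigma_algebra; exists x. Qed.

Lemma measurable_incl_event xs : measurable (incl_event xs).
Proof.
elim: xs => [|x xs IH].
  have -> : incl_event [::] = setT by apply/seteqP; split => w //= _ y.
  exact: measurableT.
have -> : incl_event (x :: xs) = (X @^-1` [set mu : config V | mu x]) `&` incl_event xs.
  apply/seteqP; split => w /=.
    move=> h; split; first by apply: h; rewrite /= mem_head.
    by move=> y yx; apply: h; rewrite /= inE; apply/orP; right.
  by move=> [Xx h] y /=; rewrite inE => /predU1P[->|/h].
apply: measurableI => //; rewrite -[X in measurable X]setTI.
exact: mX measurableT _ (measurable_coordinate x).
Qed.

Definition incl_ind xs : T -> R := \1_(incl_event xs).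

Lemma incl_ind_nil w : incl_ind [::] w = 1.
Proof. by rewrite /incl_ind indicE mem_set. Qed.

Lemma incl_indM xs ys w : incl_ind xs w * incl_ind ys w = incl_ind (xs ++ ys) w.
Proof.
rewrite /incl_ind -[LHS]/((\1_(incl_event xs) \* \1_(incl_event ys)) w) -indicI.
congr (\1_ _ _); apply/seteqP; split => v /=.
  by move=> [h1 h2] y /=; rewrite mem_cat => /orP[/h1|/h2].
by move=> h; split => y yx; apply: h => /=; rewrite mem_cat; apply/orP; [left|right].
Qed.

Lemma incl_ind_undup xs : incl_ind (undup xs) = incl_ind xs.
Proof.
rewrite /incl_ind; congr (\1_ _).
by apply/seteqP; split => w h y /= yx; apply: h; rewrite /= ?mem_undup // -mem_undup.
Qed.

Lemma square_incl_ind xs : square_integ P (incl_ind xs).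
Proof.
apply: (@square_integ_bounded _ _ _ _ 1) => [|w].
  exact/measurable_indic/measurable_incl_event.
by rewrite /incl_ind indicE; case: (_ \in _); rewrite ?normr1 ?normr0.
Qed.

Lemma local_split u us f : local_on (u :: us) f ->
  exists f1 f2 : set V -> R, [/\ local_on us f1, local_on us f2,
    forall w, f (X w) = f1 (X w) + incl_ind [:: u] w * f2 (X w)
    & forall M, (forall mu, `|f mu| <= M) ->
      (forall mu, `|f1 mu| <= M) /\ (forall mu, `|f2 mu| <= M + M)].
Proof.
move=> lf; exists (fun mu => f (mu `\` [set u])),
  (fun mu => f (mu `|` [set u]) - f (mu `\` [set u])).
have l1 : local_on us (fun mu => f (mu `\` [set u])).
  move=> mu mu' h; apply: lf => v; rewrite inE => /predU1P[->|/h hv] /=.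
    by split => -[].
  by rewrite /setD /= hv.
split => //.
- move=> mu mu' h; congr (_ - _); last exact: l1.
  apply: lf => v; rewrite inE => /predU1P[->|/h hv] /=; first by split; right.
  by rewrite hv.
- move=> w; rewrite /incl_ind indicE; have [h|h] := pselect (incl_event [:: u] w).
    rewrite mem_set // mul1r addrC subrK; apply: lf => v _ /=.
    have Xu : X w u by apply: h; rewrite /= mem_head.
    by split => [|[//|->//]]; left.
  rewrite memNset // mul0r addr0; apply: lf => v _ /=; split => [Xv|[]//].
  by split => // vu; apply: h => y /=; rewrite inE => /eqP ->; rewrite -vu.
- move=> M fM; split => mu //; rewrite (le_trans (ler_normB _ _)) //.
  exact: lerD.
Qed.

Lemma local_nil f mu : local_on [::] f -> f mu = f set0.
Proof. by move=> lf; apply: lf => u. Qed.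

(** Measurability of f is not assumed but obtained: a function of finitely many spins is a
    polynomial in their indicators. *)
Lemma measurable_local us f : local_on us f -> measurable_fun setT (f \o X).
Proof.
elim: us f => [|u us IH] f lf.
  have -> : f \o X = cst (f set0) by apply/funext => w /=; exact: local_nil.
  exact: measurable_cst.
have [f1 [f2 [l1 l2 fE _]]] := local_split lf.
have -> : f \o X = (fun w => (f1 \o X) w + incl_ind [:: u] w * (f2 \o X) w).
  by apply/funext.
apply: measurable_funD; first exact: IH.
by apply: measurable_funM; [case: (square_incl_ind [:: u])|exact: IH].
Qed.

Lemma square_local us f M : local_on us f -> (forall mu, `|f mu| <= M) ->
  square_integ P (f \o X).
Proof.
move=> lf fM; apply: (@square_integ_bounded _ _ _ _ M) => [|w]; last exact: fM.
exact: measurable_local lf.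
Qed.

(* Peeling off one site u splits f into f(mu - u) + 1_u (f(mu + u) - f(mu - u)),
   which replaces M by M and 2M. *)
Lemma Cv_local_le us f M h B xs : square_integ P h ->
  local_on us f -> (forall mu, `|f mu| <= M) ->
  (forall ys, {subset ys <= us ++ xs} -> `|Cv P (incl_ind ys) h| <= B) ->
  `|Cv P (fun w => incl_ind xs w * f (X w)) h| <= 3 ^+ size us * M * B.
Proof.
move=> sh; elim: us f M xs => [|u us IH] f M xs lf fM hB.
  have fc w : f (X w) = f set0 by exact: local_nil.
  rewrite (eq_Cv P (f' := fun w => f set0 * incl_ind xs w) (g' := h)) //; last first.
    by move=> w; rewrite fc mulrC.
  rewrite Cv_cst_mul //; last exact: square_incl_ind.
  by rewrite expr0 mul1r normrM ler_pM // hB.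
have M0 : 0 <= M := le_trans (normr_ge0 _) (fM set0).
have [f1 [f2 [l1 l2 fE bnd]]] := local_split lf.
have [b1 b2] := bnd M fM.
have si ys g N : local_on us g -> (forall mu, `|g mu| <= N) ->
    square_integ P (fun w => incl_ind ys w * g (X w)).
  move=> lg gN; apply: (square_integ_dom _ (square_local lg gN)).
    apply: measurable_funM; first by case: (square_incl_ind ys).
    exact: measurable_local lg.
  move=> w; rewrite normrM ler_piMl //= /incl_ind indicE.
  by case: (_ \in _); rewrite ?normr1 ?normr0.
rewrite (eq_Cv P (f' := fun w => incl_ind xs w * f1 (X w) +
    incl_ind (xs ++ [:: u]) w * f2 (X w)) (g' := h)) //; last first.
  by move=> w; rewrite fE mulrDr mulrA incl_indM.
rewrite CvDl //; [|exact: si b1|exact: si b2].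
rewrite (le_trans (ler_normD _ _)) //.
have h1 := IH f1 M xs l1 b1 (fun ys ysub => hB ys (fun y yy =>
  let: h := ysub y yy in ltac:(by rewrite /= inE h orbT))).
have h2 : `|Cv P (fun w => incl_ind (xs ++ [:: u]) w * f2 (X w)) h| <=
    3 ^+ size us * (M + M) * B.
  apply: IH => // ys ysub; apply: hB => y /ysub.
  by rewrite !mem_cat !inE; do 2 case: (_ \in _); rewrite ?orbT //= => ->; rewrite ?orbT.
by rewrite /= exprS; lra.
Qed.

End local_functions.

Section clustering_local.
Context (V : groupType) (S : set V) d (T : measurableType d) (R : realType)
  (P : probability T R) (X : T -> config V).
Hypothesis mX : measurable_fun setT X.
Variables (C c : nat -> R) (phi : R -> R).
Hypothesis clX : clustering S P X C c phi.

(** The clustering inequality speaks of nonempty lists of distinct points. Repetitions are removed,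
    an empty list gives covariance 0, and the monotonicity of C, c and phi replaces the actual sizes
    and distance by those of [us], [vs] and s. *)
Lemma Cv_incl_ind_le us vs xs ys s :
  {subset xs <= us} -> {subset ys <= vs} ->
  (forall u v, u \in us -> v \in vs -> (s <= gdist S u v)%N /\ u != v) ->
  `|Cv P (incl_ind R X xs) (incl_ind R X ys)|
    <= C (size us + size vs) * phi (c (size us + size vs) * s%:R).
Proof.
move=> xsub ysub sep; case: clX => _ [C0 Cle] [c0 cle] [phi01 phile _] clus.
set k := (size us + size vs)%N.
have rhs0 : 0 <= C k * phi (c k * s%:R).
  apply: mulr_ge0; first exact: ltW.
  by case/andP: (phi01 (c k * s%:R) (mulr_ge0 (ltW (c0 k)) (ler0n _ s))).
have sq := square_incl_ind P mX.
have triv zs : Cv P (incl_ind R X [::]) (incl_ind R X zs) = 0.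
  rewrite /Cv (@eq_Ex _ _ _ _ (incl_ind R X [::]) (fun=> 1)); last first.
    by move=> w; rewrite incl_ind_nil.
  rewrite Ex_cst mul1r; apply/eqP; rewrite subr_eq0; apply/eqP/eq_Ex => w.
  by rewrite incl_ind_nil mul1r.
have [/undup_nil ->|xs0] := eqVneq (undup xs) [::]; first by rewrite triv normr0.
have [/undup_nil ->|ys0] := eqVneq (undup ys) [::].
  by rewrite CvC triv normr0.
rewrite -(incl_ind_undup _ _ xs) -(incl_ind_undup _ _ ys).
set xs' := undup xs in xs0 *; set ys' := undup ys in ys0 *.
have xs'us x : x \in xs' -> x \in us by rewrite mem_undup => /xsub.
have ys'vs y : y \in ys' -> y \in vs by rewrite mem_undup => /ysub.
have szx : (size xs' <= size us)%N by rewrite uniq_leq_size ?undup_uniq.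
have szy : (size ys' <= size vs)%N by rewrite uniq_leq_size ?undup_uniq.
have un : uniq (xs' ++ ys').
  rewrite cat_uniq !undup_uniq andbT /=; apply/hasPn => y yy; apply/negP => yx.
  by have [_] := sep y y (xs'us _ yx) (ys'vs _ yy); rewrite eqxx.
have x1 : (0 < size xs')%N by rewrite lt0n size_eq0.
have y1 : (0 < size ys')%N by rewrite lt0n size_eq0.
have := clus xs' ys' x1 y1 un.
set k' := (size xs' + size ys')%N; set s' := set_gdist _ _ _.
have ss' : (s <= s')%N.
  rewrite /s' /set_gdist; set A := [set _ | _ in _ & _ in _].
  have [|[x xx [y yy <-]] _] := @nat_minP A; last first.
    by have [] := sep x y (xs'us _ xx) (ys'vs _ yy).
  have /hasP[x xx _] : has xpredT xs' by rewrite has_predT.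
  have /hasP[y yy _] : has xpredT ys' by rewrite has_predT.
  by exists (gdist S x y), x => //; exists y.
have mE := measurable_incl_event mX.
have PE A : measurable A -> P A = (Ex P \1_A)%:E.
  by move=> mA; rewrite Ex_indic // fineK // fin_num_measure.
rewrite (PE _ (mE (xs' ++ ys'))) (PE _ (mE xs')) (PE _ (mE ys')) /= lee_fin.
have -> : Cv P (incl_ind R X xs') (incl_ind R X ys') =
   Ex P \1_(incl_event X (xs' ++ ys')) -
   Ex P \1_(incl_event X xs') * Ex P \1_(incl_event X ys').
  by rewrite /Cv; congr (_ - _); apply: eq_Ex => w; rewrite incl_indM.
have k'k : (k' <= k)%N by rewrite leq_add.
move=> /le_trans; apply; rewrite ler_pM ?Cle ?(ltW (C0 _)) //.
  by case/andP: (phi01 (c k' * s'%:R) (mulr_ge0 (ltW (c0 _)) (ler0n _ _))).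
apply: phile; first by rewrite mulr_ge0 // ltW.
by apply: ler_pM; rewrite ?ler_nat ?cle //; apply: ltW.
Qed.

(** The expansion is applied to f against g, then to g against each indicator produced by f, by
    symmetry of the covariance. *)
Lemma Cv_local_clustering us vs f g M N s :
  local_on us f -> local_on vs g ->
  (forall mu, `|f mu| <= M) -> (forall mu, `|g mu| <= N) ->
  (forall u v, u \in us -> v \in vs -> (s <= gdist S u v)%N /\ u != v) ->
  `|Cv P (f \o X) (g \o X)| <= 3 ^+ size us * M * (3 ^+ size vs * N *
    (C (size us + size vs) * phi (c (size us + size vs) * s%:R))).
Proof.
move=> lf lg fM gN sep.
have sf := square_local P mX lf fM; have sg := square_local P mX lg gN.
rewrite (eq_Cv P (f' := fun w => incl_ind R X [::] w * f (X w)) (g' := g \o X)) //; last first.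
  by move=> w; rewrite incl_ind_nil mul1r.
apply: Cv_local_le => // xs xsub; rewrite CvC.
rewrite (eq_Cv P (f' := fun w => incl_ind R X [::] w * g (X w))
  (g' := incl_ind R X xs)) //; last by move=> w; rewrite incl_ind_nil mul1r.
apply: Cv_local_le => // [|ys ysub]; first exact: square_incl_ind.
rewrite CvC; apply: Cv_incl_ind_le => //.
  by move=> x /xsub; rewrite cats0.
by move=> y /ysub; rewrite cats0.
Qed.

End clustering_local.

(** * Scores and their stabilisation *)

(** Stationarity is an equality of laws, so both expectations are rewritten as integrals over the
    configuration space. *)
Lemma stationary_Ex (V : groupType) d (T : measurableType d) (R : realType)
    (P : probability T R) (X : T -> config V) (y : V) (h : config V -> R) :
  measurable_fun setT X -> measurable_fun setT (translate y : config V -> config V) ->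
  stationary P X -> measurable_fun setT h ->
  integ P (h \o X) -> integ P (h \o (translate y \o X)) ->
  Ex P (h \o (translate y \o X)) = Ex P (h \o X).
Proof.
move=> mX mt sX mh i1 i2.
have mtX : measurable_fun setT ((translate y : config V -> config V) \o X).
  exact: measurableT_comp.
pose X0 : {RV P >-> config V} := HB.pack_for {mfun T >-> config V} X
  (isMeasurableFun.Build _ _ _ _ X mX).
pose X1 : {RV P >-> config V} := HB.pack_for {mfun T >-> config V}
  ((translate y : config V -> config V) \o X) (isMeasurableFun.Build _ _ _ _ _ mtX).
have mEh : measurable_fun setT (EFin \o h) by exact/measurable_EFinP.
rewrite /Ex /Rintegral; congr fine.
have := @integral_distribution _ _ _ _ _ P X0 (EFin \o h) mEh i1.
have := @integral_distribution _ _ _ _ _ P X1 (EFin \o h) mEh i2.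
move=> /= <- <-; apply: eq_measure_integral => A mA _.
exact: sX.
Qed.

Section scores.
Variables (V : groupType) (S : set V) (R : realType) (xi : V -> set V -> R).
Hypothesis S_gen : cayley_generators S.
Hypothesis xi_score : score_function xi.
Local Open Scope group_scope.

Lemma translateE y (mu : set V) z : translate y mu z <-> mu (y^-1 * z).
Proof.
split; first by move=> [x mx <-]; rewrite mulKg.
by move=> h; exists (y^-1 * z); rewrite ?mulVKg.
Qed.

Lemma score_translate y x mu : xi x mu = xi (y * x) (translate y mu).
Proof. by case: xi_score => _ ->. Qed.

Lemma score_at1 x mu : xi x mu = xi 1 (translate x^-1 mu).
Proof. by rewrite (score_translate x^-1) mulVg. Qed.

Lemma measurable_config_map d (T : measurableType d) (f : T -> config V) :
  (forall x, measurable [set t | f t x]) -> measurable_fun setT f.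
Proof.
move=> fx; apply: (@measurability _ _ T (config V) setT f (@coordinate_events V)) => //.
by move=> _ [_ [x _ <-] <-]; rewrite setTI; exact: fx.
Qed.

Lemma measurable_translate y : measurable_fun setT (translate y : config V -> config V).
Proof.
apply: measurable_config_map => x.
rewrite (_ : [set t | _] = [set mu : config V | mu (y^-1 * x)]).
  exact: measurable_coordinate.
by apply/seteqP; split => mu /translateE.
Qed.

Lemma measurable_restrict (W : set V) :
  measurable_fun setT ((fun mu => mu `&` W) : config V -> config V).
Proof.
apply: measurable_config_map => x.
have [Wx|Wx] := pselect (W x).
  rewrite (_ : [set t | _] = [set mu : config V | mu x]).
    exact: measurable_coordinate.
  by apply/seteqP; split => mu /=; [case|].
rewrite (_ : [set t | _] = set0); first exact: measurable0.
by apply/seteqP; split => mu //= [].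
Qed.

Lemma measurable_score x : measurable_fun setT (xi x : config V -> R).
Proof.
have [mxi _ _] := xi_score.
have -> : (xi x : config V -> R) =
    (fun z : discrete V * config V => xi z.1 z.2) \o pair (x : discrete V).
  by [].
by apply: measurableT_comp => //; exact: pair1_measurable.
Qed.

Definition ball_seq x r : seq V := enum_fset (ball_at S x r).

Lemma in_ball_seq x r y : (y \in ball_seq x r) = (gdist S x y <= r)%N.
Proof. exact: in_ball_at. Qed.

Lemma size_ball_seq x r : size (ball_seq x r) = #|` ball_fset S r|.
Proof. by rewrite -(card_ball_at S x). Qed.

Lemma gball_nat r : gball S 1 (r%:R : R) = [set y | (glen S y <= r)%N].
Proof. by apply/seteqP; split => x; rewrite /gball /= ler_nat. Qed.

(** The condition inside the infimum that defines the radius of stabilisation, with r = 0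
    allowed. *)
Definition stab r (mu : set V) : Prop := forall mu',
  mu' `&` gball S 1 (r%:R : R) = mu `&` gball S 1 (r%:R : R) -> xi 1 mu = xi 1 mu'.

Definition stab_at r x mu : Prop := stab r (translate x^-1 mu).

Definition agree_on (us : seq V) (mu mu' : set V) :=
  forall u, u \in us -> (mu u <-> mu' u).

Lemma agree_translate r x mu mu' : agree_on (ball_seq x r) mu mu' ->
  translate x^-1 mu `&` gball S 1 (r%:R : R) = translate x^-1 mu' `&` gball S 1 (r%:R : R).
Proof.
move=> h; rewrite gball_nat; apply/seteqP; split => z /= [/translateE mz zr];
  split => //; apply/translateE; move: mz; rewrite invgK => mz;
  by apply/h => //; rewrite in_ball_seq gdistE // mulKg.
Qed.

(** Whether the score stabilises at radius r is itself decided by the spins in W_r(x); this is what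
    makes the truncated score a local function. *)
Lemma stab_agree r x mu mu' : agree_on (ball_seq x r) mu mu' ->
  stab_at r x mu -> stab_at r x mu' /\ xi x mu = xi x mu'.
Proof.
move=> /agree_translate h st.
have e : xi 1 (translate x^-1 mu) = xi 1 (translate x^-1 mu') by apply: st.
split; last by rewrite !(score_at1 x).
by move=> mu'' h'; rewrite -e; apply: st; rewrite h' h.
Qed.

Lemma agree_sym us mu mu' : agree_on us mu mu' -> agree_on us mu' mu.
Proof. by move=> h u /h[]. Qed.

Definition stab_ind r x (mu : set V) : R := (`[< stab_at r x mu >])%:R.

Lemma local_stab_ind r x : local_on (ball_seq x r) (stab_ind r x).
Proof.
move=> mu mu' h; rewrite /stab_ind; congr ((nat_of_bool _)%:R); apply: asbool_equiv_eq; split.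
  by case/(stab_agree h).
by case/(stab_agree (agree_sym h)).
Qed.

Definition score_cut r x mu : R := (xi x mu * stab_ind r x mu)%R.

Lemma local_score_cut r x : local_on (ball_seq x r) (score_cut r x).
Proof.
move=> mu mu' h; rewrite /score_cut (local_stab_ind h) /stab_ind.
case: asboolP => st; last by rewrite !mulr0.
by have [_ ->] := stab_agree (agree_sym h) st.
Qed.

(** On the stabilisation event the score equals that of the configuration restricted to the ball,
    for which the deterministic bound holds; elsewhere the truncated score is 0. *)
Lemma score_cut_bound r x (M : R) :
  (forall mu, `|xi 1 (mu `&` gball S 1 (r%:R : R))| <= M)%R ->
  forall mu, (`|score_cut r x mu| <= M)%R.
Proof.
move=> bM mu; rewrite /score_cut /stab_ind.
case: asboolP => st; last by rewrite mulr0 normr0 (le_trans _ (bM set0)).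
rewrite mulr1 score_at1 (st (translate x^-1 mu `&` gball S 1 (r%:R : R))) //.
by rewrite -setIA setIid.
Qed.

Lemma local_restrict us f (W : set V) : local_on us f ->
  local_on us (fun mu => f (mu `&` W) : R).
Proof. by move=> lf mu mu' h; apply: lf => u /h hu /=; rewrite /setI /= hu. Qed.

Lemma local_restrict_eq us f (W : set V) : local_on us f ->
  (forall u, u \in us -> W u) -> forall mu, f (mu `&` W) = f mu :> R.
Proof.
by move=> lf usW mu; apply: lf => u /usW Wu; split => [[]|].
Qed.

End scores.

(** * Truncated scores in finite and infinite windows *)

Section truncation.
Context (V : groupType) (S : set V) d (T : measurableType d) (R : realType)
  (P : probability T R) (X : T -> config V) (xi : V -> set V -> R).
Hypothesis S_gen : cayley_generators S.
Hypothesis xi_score : score_function xi.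
Hypothesis mX : measurable_fun setT X.

Definition wscore n x w : R := xi x (restrict_spin R S X n w).

Definition unstable n r x : set T :=
  [set w | ~ stab_at S xi r x (restrict_spin R S X n w)].

Lemma measurable_wscore n x : measurable_fun setT (wscore n x).
Proof.
apply: (measurableT_comp (measurable_score xi_score x)).
exact: (measurableT_comp (measurable_restrict (window R S n))).
Qed.

Lemma wscore_out n x w : ~ window R S n x -> wscore n x w = 0.
Proof. by move=> nWx; case: xi_score => _ _; apply => -[_ /nWx]. Qed.

Lemma wscore_cut n r x w : wscore n x w * \1_(~` unstable n r x) w =
  score_cut S xi r x (restrict_spin R S X n w).
Proof.
rewrite /score_cut /stab_ind indicE; congr (_ * (nat_of_bool _)%:R).
by apply/idP/asboolP; rewrite inE /unstable /= => h; [apply: contrapT|].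
Qed.

(** Stability quantifies over all configurations, but its indicator depends on finitely many spins,
    and that gives measurability. *)
Lemma measurable_unstable n r x : measurable (unstable n r x).
Proof.
have mf : measurable_fun setT (fun w => stab_ind S xi r x (X w `&` window R S n)).
  apply: (measurable_local P mX (us := ball_seq S x r)
    (f := fun mu => stab_ind S xi r x (mu `&` window R S n))).
  by apply: (local_restrict (f := stab_ind S xi r x)); exact: local_stab_ind.
rewrite (_ : unstable n r x = (fun w => stab_ind S xi r x (X w `&` window R S
  n)) @^-1` [set 0]).
  by rewrite -[X in measurable X]setTI; exact: mf.
apply/seteqP; split => w /=; rewrite /stab_ind /unstable /=; case: asboolP => //.
by move=> _ /eqP; rewrite oner_eq0.
Qed.

Lemma mass_on_le f D : square_integ P f -> measurable D ->
  mass_on P f D <= mass_on P f setT.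
Proof.
move=> sf mD; apply: Ex_le => [||w]; try exact: integ_mass.
rewrite [\1_setT _]indicE in_setT mulr1 indicE; case: (_ \in _); rewrite ?mulr1 //.
by rewrite mulr0 addr_ge0 // sqr_ge0.
Qed.

Lemma Cv_crude u v K : square_integ P u -> square_integ P v ->
  mass_on P u setT <= K -> mass_on P v setT <= K -> `|Cv P u v| <= K + K * K.
Proof.
move=> su sv uK vK; rewrite /Cv (le_trans (ler_normB _ _)) // lerD //.
  apply: (@le_trans _ _ (2^-1 * (mass_on P u setT + mass_on P v setT))); last by lra.
  have iu := integ_mass su measurableT; have iv := integ_mass sv measurableT.
  rewrite /mass_on -ExD // -ExZ; last exact: integD.
  apply: Ex_norm_le; [exact: square_integM|by apply: integZ; exact: integD|].
  move=> w; rewrite indicE in_setT !mulr1 normrM.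
  rewrite -(real_normK (num_real (u w))) -(real_normK (num_real (v w))).
  by have := sqr_ge0 (`|u w| - `|v w|); rewrite !expr2; nra.
rewrite normrM ler_pM //.
  exact: le_trans (Ex_le_mass su) uK.
exact: le_trans (Ex_le_mass sv) vK.
Qed.

Variables (C c : nat -> R) (phi : R -> R).
Hypothesis clX : clustering S P X C c phi.
Variables (K : R) (tau M : nat -> R).
Hypothesis wscore_sq : forall n x, window_index n -> square_integ P (wscore n x).
Hypothesis wscore_mass : forall n x, window_index n -> window R S n x ->
  mass_on P (wscore n x) setT <= K.
Hypothesis wscore_tau : forall n r x y, window_index n ->
  window R S n x -> window R S n y ->
  mass_on P (wscore n x) (unstable n r y) <= tau r.
Hypothesis score_bound : forall r mu, `|xi 1%g (mu `&` gball S 1%g (r%:R : R))| <= M r.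

Definition cluster_bound r s : R :=
  let k := #|` ball_fset S r| in
  3 ^+ k * M r * (3 ^+ k * M r * (C (k + k) * phi (c (k + k) * s%:R))).

Lemma score_cut_window n r x : window_index n -> window R S n x ->
  forall y, window R S n y ->
  `|Cv P (wscore n x) (wscore n y) -
    Cv P (fun w => score_cut S xi r x (restrict_spin R S X n w))
         (fun w => score_cut S xi r y (restrict_spin R S X n w))|
  <= (2 + 2 * K) * tau r.
Proof.
move=> ni nx y ny.
have := @Cv_cut _ _ _ P (wscore n x) (wscore n y) (unstable n r x)
  (unstable n r y) (tau r) K (wscore_sq x ni) (wscore_sq y ni)
  (measurable_unstable n r x) (measurable_unstable n r y)
  (wscore_tau _ ni nx nx) (wscore_tau _ ni ny nx) (wscore_tau _ ni nx ny)
  (wscore_tau _ ni ny ny) (wscore_mass ni nx) (wscore_mass ni ny).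
by rewrite (eq_Cv P (wscore_cut n r x) (wscore_cut n r y)).
Qed.

(** The truncated scores depend on the r-balls around x and y, which are at least d(x, y) - 2r
    apart; the rest is truncation error. *)
Lemma wscore_Cv_decay n x y r : window_index n -> window R S n x ->
  window R S n y -> (2 * r < gdist S x y)%N ->
  `|Cv P (wscore n x) (wscore n y)| <=
    (2 + 2 * K) * tau r + cluster_bound r (gdist S x y - 2 * r).
Proof.
move=> ni nx ny rxy.
have h1 := score_cut_window r ni nx ny.
have lcut z : local_on (ball_seq S z r)
    (fun mu => score_cut S xi r z (mu `&` window R S n)).
  by apply: (local_restrict (f := score_cut S xi r z)); exact: local_score_cut.
have h2 := @Cv_local_clustering _ S _ _ _ P X mX C c phi clX _ _ _ _ _ _
  (gdist S x y - 2 * r)%N (lcut x) (lcut y)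
  (fun mu => score_cut_bound xi_score x (score_bound r) (mu `&` window R S n))
  (fun mu => score_cut_bound xi_score y (score_bound r) (mu `&` window R S n)).
rewrite !size_ball_seq // -/(cluster_bound _ _) in h2.
rewrite -[Cv _ _ _](subrK (Cv P (fun w => score_cut S xi r x (restrict_spin R S X n w))
  (fun w => score_cut S xi r y (restrict_spin R S X n w)))).
apply: (le_trans (ler_normD _ _)); apply: lerD => //; apply: h2 => u v.
rewrite !in_ball_seq // => xu yv.
have t1 := gdist_triangle S_gen u x y; have t2 := gdist_triangle S_gen v u y.
have vy := gdist_sym S_gen v y.
split; first lia.
by apply/eqP => uv; rewrite uv gdistxx in t2 *; rewrite uv in t1 xu; lia.
Qed.

Definition deep n r x : Prop := forall y, (gdist S x y <= r)%N -> (glen S y <= n)%N.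

Lemma deep_window n r x : deep n r x -> window R S (Some n) x.
Proof. by move=> h; rewrite windowE /=; apply: h; rewrite gdistxx. Qed.

Lemma score_cut_deep n r x : deep n r x ->
  (fun w => score_cut S xi r x (restrict_spin R S X (Some n) w)) =1
  (fun w => score_cut S xi r x (restrict_spin R S X None w)).
Proof.
move=> dx w; rewrite /restrict_spin setIT.
apply: (local_restrict_eq (us := ball_seq S x r)); first exact: local_score_cut.
by move=> u; rewrite in_ball_seq // windowE => /dx.
Qed.

(** At deep points the truncated scores for W_n and for V coincide, so only the two truncation
    errors remain. *)
Lemma wscore_Cv_window n r x y : (0 < n)%N -> deep n r x -> deep n r y ->
  `|Cv P (wscore (Some n) x) (wscore (Some n) y) -
    Cv P (wscore None x) (wscore None y)| <= 2 * ((2 + 2 * K) * tau r).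
Proof.
move=> n0 dx dy.
have h1 := @score_cut_window (Some n) r x n0 (deep_window dx) y (deep_window dy).
have h2 := @score_cut_window None r x I I y I.
rewrite (eq_Cv P (@score_cut_deep n r x dx) (@score_cut_deep n r y dy)) in h1.
move: h1 h2; rewrite !ler_norml => /andP[h1 h1'] /andP[h2 h2'].
by apply/andP; split; lra.
Qed.

Lemma wscore_Ex_window n r x : (0 < n)%N -> deep n r x ->
  `|Ex P (wscore (Some n) x) - Ex P (wscore None x)| <= 2 * tau r.
Proof.
move=> n0 dx.
have wx := deep_window dx.
have h1 := le_trans (Ex_cut (@wscore_sq (Some n) x n0) (measurable_unstable (Some n) r x))
  (@wscore_tau (Some n) r x x n0 wx wx).
have h2 := le_trans (Ex_cut (@wscore_sq None x I) (measurable_unstable None r x))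
  (@wscore_tau None r x x I I I).
rewrite (eq_Ex P (wscore_cut (Some n) r x)) (eq_Ex P (@score_cut_deep n r x dx)) in h1.
rewrite (eq_Ex P (wscore_cut None r x)) in h2.
move: h1 h2; rewrite !ler_norml => /andP[h1 h1'] /andP[h2 h2'].
by apply/andP; split; lra.
Qed.

Lemma wscoreNone x w : wscore None x w = xi x (X w).
Proof. by rewrite /wscore /restrict_spin setIT. Qed.

Lemma stationary_moment (F : set V -> R) x :
  measurable_fun setT (F : config V -> R) ->
  integ P (F \o X) -> integ P (fun w => F (translate x^-1%g (X w))) ->
  Ex P (fun w => F (translate x^-1%g (X w))) = Ex P (F \o X).
Proof.
move=> mF i1 i2; case: clX => -[sX _] _ _ _ _.
exact: (stationary_Ex mX (measurable_translate _) sX mF i1 i2).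
Qed.

Lemma wscore_translate x y w :
  wscore None y w = xi (x^-1 * y)%g (translate x^-1%g (X w)).
Proof. by rewrite wscoreNone -score_translate. Qed.

(** Translation by x^-1 preserves the law of P but moves W_n, hence the restriction to the infinite
    window. *)
Lemma wscore_Ex_stationary x : Ex P (wscore None x) = Ex P (wscore None 1%g).
Proof.
have e1 y : wscore None y = fun w => xi y (X w) by apply/funext => w; exact: wscoreNone.
have i1 := square_integ_integ (@wscore_sq None 1%g I).
have i2 := square_integ_integ (@wscore_sq None x I).
have e2 : wscore None x = fun w => xi 1%g (translate x^-1%g (X w)).
  by apply/funext => w; rewrite (wscore_translate x) mulVg.
rewrite e2 e1; rewrite e2 in i2; rewrite e1 in i1.
exact: (stationary_moment (measurable_score xi_score 1%g) i1 i2).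
Qed.

Lemma wscore_Cv_stationary x y : Cv P (wscore None x) (wscore None y) =
  Cv P (wscore None 1%g) (wscore None (x^-1 * y)%g).
Proof.
rewrite /Cv !(wscore_Ex_stationary x) !(wscore_Ex_stationary y)
  !(wscore_Ex_stationary (x^-1 * y)%g); congr (_ - _).
have e1 : (fun w => wscore None 1%g w * wscore None (x^-1 * y)%g w) =
    (fun mu => xi 1%g mu * xi (x^-1 * y)%g mu) \o X.
  by apply/funext => w; rewrite !wscoreNone.
have e2 : (fun w => wscore None x w * wscore None y w) =
    fun w => xi 1%g (translate x^-1%g (X w)) * xi (x^-1 * y)%g (translate x^-1%g (X w)).
  by apply/funext => w; rewrite !(wscore_translate x) mulVg.
have i1 := square_integM (@wscore_sq None 1%g I) (@wscore_sq None (x^-1 * y)%g I).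
have i2 := square_integM (@wscore_sq None x I) (@wscore_sq None y I).
rewrite e1 e2; rewrite e1 in i1; rewrite e2 in i2.
apply: (@stationary_moment (fun mu => xi 1%g mu * xi (x^-1 * y)%g mu)) => //.
by apply: measurable_funM; exact: measurable_score.
Qed.

End truncation.

(** * Unordered sums *)

Section sums.
Variables (R : realType) (V : choiceType).
Implicit Types (F E : {fset V}) (g : V -> R).

Lemma sum_fsubset g F E : (forall z, 0 <= g z) -> (F `<=` E)%fset ->
  \sum_(z <- F) g z <= \sum_(z <- E) g z.
Proof.
move=> g0 FE; rewrite [leRHS](big_fsetID _ (mem F)) /=.
rewrite (_ : [fset x in E | x \in F]%fset = F) ?lerDl ?sumr_ge0 //.
apply/fsetP => z; rewrite !inE /=; apply/andP/idP => [[]//|zF].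
by split => //; exact: (fsubsetP FE).
Qed.

Lemma sum_fsetU_disjoint g F E : [disjoint F & E]%fset ->
  \sum_(z <- (F `|` E)%fset) g z = \sum_(z <- F) g z + \sum_(z <- E) g z.
Proof.
move=> dFE; rewrite (big_fsetID _ (mem F)) /=; congr (_ + _).
  apply: eq_fbigl => z; rewrite !inE /=.
  by case: (z \in F); rewrite //= andbF.
apply: eq_fbigl => z; rewrite !inE /=.
by case: (boolP (z \in F)) => [zF|_] /=; rewrite ?andbT // (negPf (fdisjointP dFE _ zF)).
Qed.

(** The unordered sum is a supremum over finite subsets; bounded partial sums make it a real number
    approached by finite sums. *)
Lemma esum_real g (Gam : R) : (forall z, 0 <= g z) ->
  (forall F, \sum_(z <- F) g z <= Gam) ->
  exists s : R, [/\ (\esum_(z in [set: V]) (g z)%:E = s%:E)%E,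
    forall F, \sum_(z <- F) g z <= s
    & forall e, 0 < e -> exists F, s - e <= \sum_(z <- F) g z].
Proof.
move=> g0 gG; pose t := (\esum_(z in [set: V]) (g z)%:E)%E.
have tG : (t <= Gam%:E)%E.
  apply: ge_ereal_sup => _ [A [fA _] <-].
  by rewrite fsbig_finite // sumEFin lee_fin.
have tF F : ((\sum_(z <- F) g z)%:E <= t)%E.
  apply: ereal_sup_ubound; exists [set` F]; first by split.
  by rewrite fsbig_finite // set_fsetK sumEFin.
have tfin : t \is a fin_num.
  rewrite fin_numElt (lt_le_trans _ (tF fset0)) ?ltNyr //=.
  exact: le_lt_trans tG (ltry _).
exists (fine t); split => [|F|e e0]; first by rewrite fineK.
  by rewrite -lee_fin fineK.
have [_ [A [fA _] <-]] := ub_ereal_sup_adherent e0 tfin.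
rewrite fsbig_finite // sumEFin -/(esum _ _) -/t => h; exists (fset_set A).
by rewrite -lee_fin EFinB fineK // ltW.
Qed.

End sums.

Section signed_sums.
Variables (R : realType) (V : groupType) (f : V -> R) (Gam : R).
Hypothesis f_sum : forall F : {fset V}, \sum_(z <- F) `|f z| <= Gam.

Lemma summable_real : summable [set: V] (EFin \o f).
Proof.
have [s [sE _ _]] := esum_real (fun z => normr_ge0 (f z)) f_sum.
by rewrite /summable (eq_esum (b := fun z => `|f z|%:E)) // sE ltry.
Qed.

Lemma signed_sum_real :
  exists s : R, signed_sum (EFin \o f) = s%:E /\
    forall e, 0 < e -> exists F : {fset V}, forall E, (F `<=` E)%fset ->
      `|\sum_(z <- E) f z - s| <= e.
Proof.
pose fp z := Num.max (f z) 0; pose fn z := Num.max (- f z) 0.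
have fpE z : 0 <= fp z <= `|f z|.
  by rewrite /fp le_max lexx orbT /= ge_max ler_norm normr_ge0.
have fnE z : 0 <= fn z <= `|f z|.
  by rewrite /fn le_max lexx orbT /= ge_max normr_ge0 andbT -normrN ler_norm.
have [||sp [spE spF spe]] := @esum_real _ _ fp Gam.
- by move=> z; case/andP: (fpE z).
- move=> F; apply: le_trans (f_sum F); apply: ler_sum => z _; by case/andP: (fpE z).
have [||sn [snE snF sne]] := @esum_real _ _ fn Gam.
- by move=> z; case/andP: (fnE z).
- move=> F; apply: le_trans (f_sum F); apply: ler_sum => z _; by case/andP: (fnE z).
exists (sp - sn); split.
  rewrite /signed_sum EFinB -spE -snE; congr (_ - _)%E; apply: eq_esum => z _.
    by rewrite funeposE /fp EFin_max.
  by rewrite funenegE /fn EFin_max EFinN.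
move=> e e0; have [F1 F1P] := spe e e0; have [F2 F2P] := sne e e0.
exists (F1 `|` F2)%fset => E /fsubUsetP[F1E F2E].
have fE : \sum_(z <- E) f z = \sum_(z <- E) fp z - \sum_(z <- E) fn z.
  rewrite -sumrB; apply: eq_bigr => z _; rewrite /fp /fn.
  by case: (lerP (f z) 0); case: (lerP (- f z) 0); lra.
have p1 := sum_fsubset (fun z => (andP (fpE z)).1) F1E.
have n1 := sum_fsubset (fun z => (andP (fnE z)).1) F2E.
have := spF E; have := snF E; rewrite fE ler_norml => h1 h2.
by apply/andP; split; lra.
Qed.

End signed_sums.

(** * Limits of averages over balls *)

Definition score_limits (V : groupType) (S : set V) d (T : measurableType d)
    (R : realType) (P : probability T R) (X : T -> set V) (xi : V -> set V -> R) :
    Prop :=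
  [/\ summable [set: V] (score_cov P X xi),
      (0 <= sigma2 P X xi < +oo)%E,
      (((vol R S n)%:R^-1)%:E * 'V_P[score_sum S X xi n])%E @[n --> \oo]
        --> sigma2 P X xi,
      P.-integrable setT (EFin \o (fun w => xi 1%g (X w)))
    & cvg_in_probability P
        (fun n w => (vol R S n)%:R^-1 * score_sum S X xi n w)
        (fine 'E_P[fun w => xi 1%g (X w)])].

Section limit.
Context (V : groupType) (S : set V) d (T : measurableType d) (R : realType)
  (P : probability T R) (X : T -> config V) (xi : V -> set V -> R).
Hypothesis S_gen : cayley_generators S.
Hypothesis V_infinite : infinite_set [set: V].
Hypothesis xi_score : score_function xi.
Hypothesis amenable : b_amenable R S.

Local Notation Y := (wscore S X xi).
Local Notation B n := (ball_fset S n).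
Local Notation w n := (#|` ball_fset S n|).

Variables (G : nat -> R) (Gam K : R).
Hypothesis Y_sq : forall n x, window_index n -> square_integ P (Y n x).
Hypothesis G_ge0 : forall s, 0 <= G s.
Hypothesis G_sum : forall F : {fset V}, \sum_(z <- F) G (glen S z) <= Gam.
Hypothesis Cv_decay : forall n x y, window_index n ->
  window R S n x -> window R S n y -> `|Cv P (Y n x) (Y n y)| <= G (gdist S x y).
Hypothesis Cv_window : forall e : R, 0 < e -> exists r, forall n x y, (0 < n)%N ->
  deep S n r x -> deep S n r y ->
  `|Cv P (Y (Some n) x) (Y (Some n) y) - Cv P (Y None x) (Y None y)| <= e.
Hypothesis Ex_bound : forall n x, window_index n -> window R S n x ->
  `|Ex P (Y n x)| <= K.
Hypothesis Ex_window : forall e : R, 0 < e -> exists r, forall n x, (0 < n)%N ->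
  deep S n r x -> `|Ex P (Y (Some n) x) - Ex P (Y None x)| <= e.
Hypothesis Cv_stat : forall x y,
  Cv P (Y None x) (Y None y) = Cv P (Y None 1%g) (Y None (x^-1 * y)%g).
Hypothesis Ex_stat : forall x, Ex P (Y None x) = Ex P (Y None 1%g).

Let f z := Cv P (Y None 1%g) (Y None z).
Let m := Ex P (Y None 1%g).

Lemma windowP n x : window R S (Some n) x <-> x \in B n.
Proof. by rewrite windowE in_ball_fset. Qed.

Lemma deep_not_nondeep n r x : x \in B n -> x \notin nondeep S n r -> deep S n r x.
Proof.
move=> xn; rewrite !inE /= xn /= negbK => /fsubsetP h y xy.
by rewrite -in_ball_fset // h // in_ball_at.
Qed.

Lemma deep_shift n r k x y : deep S n (k + r) x -> (gdist S x y <= k)%N ->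
  deep S n r y.
Proof.
move=> dx xy z yz; apply: dx.
by apply: leq_trans (gdist_triangle S_gen y _ _) _; rewrite leq_add.
Qed.

Lemma shift_sum (F : {fset V}) (g : V -> R) x :
  \sum_(y <- F) g (x^-1 * y)%g = \sum_(z <- [fset (x^-1 * y)%g | y in F]%fset) g z.
Proof. by rewrite big_imfset //= => a b _ _; apply: mulgI. Qed.

Lemma G_sum_at x (F : {fset V}) : \sum_(y <- F) G (gdist S x y) <= Gam.
Proof.
rewrite (eq_bigr (fun y => G (glen S (x^-1 * y)%g))); last first.
  by move=> y _; rewrite gdistE.
by rewrite (shift_sum F (fun z => G (glen S z))).
Qed.

Lemma norm_f z : `|f z| <= G (glen S z).
Proof. exact: (@Cv_decay None 1%g z). Qed.

Lemma f_sum (F : {fset V}) : \sum_(z <- F) `|f z| <= Gam.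
Proof.
by apply: le_trans (G_sum F); apply: ler_sum => z _; exact: norm_f.
Qed.

Lemma fset_sub_ball (F : {fset V}) : exists n, (F `<=` B n)%fset.
Proof.
exists (\max_(z <- F) glen S z)%N; apply/fsubsetP => z zF.
by rewrite in_ball_fset // leq_bigmax_seq.
Qed.

Lemma G_tail e : 0 < e -> exists k0, forall k, (k0 <= k)%N ->
  forall F : {fset V}, [disjoint B k & F]%fset -> \sum_(z <- F) G (glen S z) <= e.
Proof.
move=> e0; have [s [_ sG /(_ e e0)[F0 F0P]]] := esum_real (fun z => G_ge0 (glen S z)) G_sum.
have [k0 F0k] := fset_sub_ball F0; exists k0 => k kk F dF.
have := sG (B k `|` F)%fset; rewrite (sum_fsetU_disjoint _ dF).
have := sum_fsubset (fun z => G_ge0 (glen S z)) (fsubset_trans F0k (sub_ball_fset S_gen kk)).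
by lra.
Qed.

Let row n x := \sum_(y <- B n) Cv P (Y (Some n) x) (Y (Some n) y).

Lemma row_le n x : (0 < n)%N -> x \in B n -> `|row n x| <= Gam.
Proof.
move=> n0 xn; apply: le_trans (G_sum_at x (B n)); apply: le_trans (ler_norm_sum _ _ _) _.
rewrite big_seq [leRHS]big_seq; apply: ler_sum => y yn.
by apply: Cv_decay => //; exact/windowP.
Qed.

(** Points within k of x contribute w_k errors e1 after comparison with the infinite window and
    translation to 1; the others are bounded by the tail of G. Depth k + r makes every point within
    k of x deep at level r. *)
Lemma row_deep k r n x e1 e2 : (0 < n)%N -> deep S n (k + r) x ->
  (forall n x y, (0 < n)%N -> deep S n r x -> deep S n r y ->
  `|Cv P (Y (Some n) x) (Y (Some n) y) - Cv P (Y None x) (Y None y)| <= e1) ->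
  (forall F : {fset V}, [disjoint B k & F]%fset -> \sum_(z <- F) G (glen S z) <= e2) ->
  `|row n x - \sum_(z <- B k) f z| <= (w k)%:R * e1 + e2.
Proof.
move=> n0 dx h1 h2.
have kn : (ball_at S x k `<=` B n)%fset.
  apply/fsubsetP => y; rewrite in_ball_at // => xy; rewrite in_ball_fset //.
  by apply: dx; rewrite (leq_trans xy) // leq_addr.
have split_row : row n x = \sum_(y <- ball_at S x k) Cv P (Y (Some n) x) (Y (Some n) y) +
    \sum_(y <- (B n `\` ball_at S x k)%fset) Cv P (Y (Some n) x) (Y (Some n) y).
  rewrite -sum_fsetU_disjoint; last first.
    by apply/fdisjointP => y yk; rewrite inE yk.
  by rewrite /row; apply: eq_fbigl => y; rewrite !inE;
    case: (boolP (y \in ball_at _ _ _)) => // /(fsubsetP kn).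
have shift : \sum_(z <- B k) f z = \sum_(y <- ball_at S x k) Cv P (Y None x) (Y None y).
  rewrite big_imfset /=; last by move=> a b _ _; apply: mulgI.
  by apply: eq_bigr => z _; rewrite Cv_stat mulKg.
rewrite split_row shift addrAC -sumrB; apply: le_trans (ler_normD _ _) _.
apply: lerD.
  apply: le_trans (ler_norm_sum _ _ _) _.
  rewrite -(card_ball_at S x k).
  apply: (@le_trans _ _ (\sum_(y <- ball_at S x k) e1)).
    rewrite big_seq [leRHS]big_seq; apply: ler_sum => y.
    rewrite in_ball_at // => xy; apply: h1 => //; last exact: deep_shift xy.
    by apply: (deep_shift dx); rewrite gdistxx.
  by rewrite big_const_seq count_predT iter_addr_0 mulr_natl.
apply: (@le_trans _ _ (\sum_(y <- (B n `\` ball_at S x k)%fset) G (gdist S x y))).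
  apply: le_trans (ler_norm_sum _ _ _) _.
  rewrite big_seq [leRHS]big_seq; apply: ler_sum => y.
  rewrite inE => /andP[_ yn]; apply: Cv_decay => //; last exact/windowP.
  by apply: deep_window => //; exact: dx.
rewrite (eq_bigr (fun y => G (glen S (x^-1 * y)%g))); last first.
  by move=> y _; rewrite gdistE.
rewrite (shift_sum _ (fun z => G (glen S z))); apply: h2.
apply/fdisjointP => z; rewrite in_ball_fset // => zk; apply/negP => /imfsetP[y /=].
by rewrite inE in_ball_at // gdistE // => /andP[/negP yk _] zE; apply: yk; rewrite -zE.
Qed.

(* By amenability all but o(w_n) points of W_n are deep. *)
Lemma average_cvg (F : nat -> V -> R) l K0 :
  (forall n x, (0 < n)%N -> x \in B n -> `|F n x - l| <= K0) ->
  (forall e, 0 < e -> exists r, forall n x, (0 < n)%N -> deep S n r x ->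
     `|F n x - l| <= e) ->
  (w n)%:R^-1 * \sum_(x <- B n) F n x @[n --> \oo] --> l.
Proof.
move=> FK Fdeep; apply/cvg_seqP => e e0.
have K00 : 0 <= K0.
  by apply: le_trans (normr_ge0 _) (FK 1%N 1%g isT _); rewrite in_ball_fset // glen1.
have e2 : 0 < e / 2 by lra.
have [r rP] := Fdeep _ e2.
have [|N NP] := b_amenable_nondeep S_gen r amenable (e := e / 2 / (K0 + 1)).
  by rewrite divr_gt0 //; lra.
exists (maxn N 1) => n; rewrite geq_max => /andP[Nn n0].
have w0 : 0 < (w n)%:R :> R by rewrite ltr0n vol_gt0.
have sub : \sum_(x <- B n) (F n x - l) = \sum_(x <- B n) F n x - (w n)%:R * l.
  by rewrite sumrB big_const_seq count_predT iter_addr_0 mulr_natl.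
rewrite (_ : _ - l = (w n)%:R^-1 * \sum_(x <- B n) (F n x - l)); last first.
  by rewrite sub mulrBr mulKf // lt0r_neq0.
rewrite normrM ger0_norm ?invr_ge0 ?(ltW w0) // mulrC ler_pdivrMr //.
apply: le_trans (ler_norm_sum _ _ _) _.
apply: (@le_trans _ _ (\sum_(x <- B n) (e / 2 + K0 * (x \in nondeep S n r)%:R))).
  rewrite big_seq [leRHS]big_seq; apply: ler_sum => x xn.
  case: (boolP (x \in nondeep S n r)) => xnd.
    by rewrite mulr1; apply: le_trans (FK n x n0 xn) _; lra.
  by rewrite mulr0 addr0; apply: rP => //; exact: deep_not_nondeep.
rewrite big_split /= big_const_seq count_predT iter_addr_0 -mulr_natl -mulr_sumr.
have cnt : \sum_(x <- B n) (x \in nondeep S n r)%:R <= (#|` nondeep S n r|)%:R :> R.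
  rewrite -natr_sum ler_nat (eq_bigr (fun x => if x \in nondeep S n r then 1 else 0)%N).
    rewrite -big_mkcond sum1_count -size_filter; apply: uniq_leq_size.
      by rewrite filter_uniq // fset_uniq.
    by move=> x; rewrite mem_filter => /andP[].
  by move=> x _; case: (_ \in _).
have c2 : K0 * (#|` nondeep S n r|)%:R <= e / 2 * (w n)%:R.
  apply: le_trans (ler_wpM2l K00 (NP n Nn)) _; rewrite mulrA ler_pM2r //.
  rewrite mulrCA ler_piMr ?(ltW e2) // ler_pdivrMr; lra.
have := ler_wpM2l K00 cnt; lra.
Qed.

(** The infinitude of V enters here; it makes the variance of the average vanish in the weak law. *)
Lemma vol_unbounded M : exists N, forall n, (N <= n)%N -> M <= (w n)%:R :> R.
Proof.
have [F _ FM] := infinite_set_fset (Num.truncn M).+1 V_infinite.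
have [N FN] := fset_sub_ball F.
exists N => n Nn; apply: le_trans (ltW (truncnS_gt M)) _; rewrite ler_nat.
apply: leq_trans FM _; apply: fsubset_leq_card.
by apply: fsubset_trans FN (sub_ball_fset S_gen Nn).
Qed.

Let H n := score_sum S X xi n.

(** Since the score vanishes off the configuration, the random index set can be replaced by the
    fixed set W_n. *)
Lemma score_sumE n : H n = fun w => \sum_(x <- B n) Y (Some n) x w.
Proof.
apply/funext => t; rewrite /H /score_sum.
set Xn := restrict_spin R S X (Some n) t.
have fX : finite_set Xn.
  by apply: (sub_finite_set _ (finite_fset (B n))) => x [_ /windowP].
rewrite fsbig_finite //=; apply: big_fset_incl => [|x xn].
  by apply/fsubsetP => x; rewrite in_fset_set // inE => -[_ /windowP].
rewrite in_fset_set // => xX; case: xi_score => _ _; apply => Xx.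
by move/negP: xX; apply; rewrite inE.
Qed.

Lemma H_sq n : (0 < n)%N -> square_integ P (H n).
Proof. by move=> n0; rewrite score_sumE; apply: square_integ_sum => x; exact: Y_sq. Qed.

Lemma Cv_H n : (0 < n)%N -> Cv P (H n) (H n) = \sum_(x <- B n) row n x.
Proof. by move=> n0; rewrite score_sumE Cv_sum // => x; exact: Y_sq. Qed.

Lemma Ex_H n : (0 < n)%N -> Ex P (H n) = \sum_(x <- B n) Ex P (Y (Some n) x).
Proof.
by move=> n0; rewrite score_sumE Ex_sum // => x; apply: square_integ_integ; exact: Y_sq.
Qed.

Lemma score_covE : score_cov P X xi = EFin \o f.
Proof.
apply/funext => z; have e y : Y None y = fun t => xi y (X t).
  by apply/funext => t; rewrite wscoreNone.
by rewrite /score_cov /= -!e covE //; exact: Y_sq.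
Qed.

Lemma variance_cvg_real : exists s : R, sigma2 P X xi = s%:E /\
  (w n)%:R^-1 * \sum_(x <- B n) row n x @[n --> \oo] --> s.
Proof.
have [s [sE sP]] := signed_sum_real f_sum.
exists s; rewrite /sigma2 score_covE; split => //.
have s_le : `|s| <= Gam.
  apply/ler_addgt0Pr => e e0; have [F FP] := sP e e0.
  have h1 := FP F (fsubset_refl F).
  have h2 : `|\sum_(z <- F) f z| <= Gam.
    exact: le_trans (ler_norm_sum _ _ _) (f_sum F).
  have := ler_normD (s - \sum_(z <- F) f z) (\sum_(z <- F) f z).
  by rewrite subrK distrC; lra.
apply: (@average_cvg _ _ (Gam + Gam)) => [n x n0 xn|e e0].
  by apply: le_trans (ler_normB _ _) _; apply: lerD => //; exact: row_le.
(* The three thirds are the comparison with the infinite window, the tail of G, and the distance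
   from s of the partial sum over [B k]. The first is a sum of w_k errors, hence the division by w_k
   below. *)
have e3 : 0 < e / 3 by lra.
have [F FP] := sP _ e3; have [k1 Fk] := fset_sub_ball F.
have [k2 k2P] := G_tail e3; pose k := maxn k1 k2.
have wk : 0 < (w k)%:R :> R by rewrite ltr0n vol_gt0.
have [|r rP] := Cv_window (e := e / 3 / (w k)%:R); first by rewrite divr_gt0.
exists (k + r)%N => n x n0 dx.
have h1 := row_deep n0 dx rP (k2P k (leq_maxr _ _)).
rewrite mulrCA mulfV ?lt0r_neq0 // mulr1 in h1.
have h2 := FP (B k) (fsubset_trans Fk (sub_ball_fset S_gen (leq_maxl _ _))).
rewrite (_ : _ - s = (row n x - \sum_(z <- B k) f z) + (\sum_(z <- B k) f z - s));
  last by ring.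
by apply: le_trans (ler_normD _ _) _; lra.
Qed.

Lemma Cv_ge0 (h : T -> R) : square_integ P h -> 0 <= Cv P h h.
Proof. by move=> sh; rewrite -lee_fin -covE //; exact: variance_ge0. Qed.

Lemma cvg_EFin_from1 (u : nat -> \bar R) (v : nat -> R) l :
  (forall n, (0 < n)%N -> u n = (v n)%:E) -> (v n @[n --> \oo] --> l) ->
  u n @[n --> \oo] --> l%:E.
Proof.
move=> uv vl; apply/fine_cvgP; split; first by exists 1%N => // n /= n0; rewrite uv.
apply: cvg_trans vl; apply: near_eq_cvg; exists 1%N => // n /= n0.
by rewrite uv.
Qed.

(** The centre l need not be the mean of h, so the squared bias is added to the variance. *)
Lemma chebyshev_real (h : T -> R) (l e : R) : 0 < e -> square_integ P h ->
  (P [set t | (e < `|h t - l|)%R] <=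
    (e ^- 2 * (Cv P h h + (Ex P h - l) * (Ex P h - l)))%:E)%E.
Proof.
move=> e0 sh.
have mhl : measurable_fun setT (fun t => `|h t - l|).
  by apply: measurableT_comp => //; apply: measurable_funB => //; case: sh.
have mA : measurable [set t | e < `|h t - l|].
  rewrite (_ : [set t | _] = (fun t => `|h t - l|) @^-1` `]e, +oo[).
    by rewrite -[X in measurable X]setTI; apply: mhl.
  by apply/seteqP; split => t /=; rewrite in_itv /= andbT.
rewrite -[P _]fineK; last exact: fin_num_measure.
rewrite lee_fin -Ex_indic //.
have i2 := square_integM sh sh; have i1 := square_integ_integ sh.
have -> : Cv P h h + (Ex P h - l) * (Ex P h - l) =
    Ex P (fun t => h t * h t + (- (2 * l) * h t + l * l)).
  rewrite ExD //; last by apply: integD; [exact: integZ|exact: integ_cst].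
  rewrite ExD ?Ex_cst ?ExZ //; [|exact: integZ|exact: integ_cst].
  by rewrite /Cv; ring.
have iall : integ P (fun t => h t * h t + (- (2 * l) * h t + l * l)).
  by apply: integD => //; apply: integD; [exact: integZ|exact: integ_cst].
rewrite -ExZ //; apply: Ex_le; [exact: integ_indic|exact: integZ|move=> t].
have -> : h t * h t + (- (2 * l) * h t + l * l) = `|h t - l| ^+ 2.
  by rewrite real_normK ?num_real //; ring.
rewrite indicE; case: (boolP (t \in _)); rewrite ?inE /=; last first.
  by rewrite mulr_ge0 ?invr_ge0 ?exprn_ge0 ?(ltW e0).
by move=> et; rewrite mulrC ler_pdivlMr ?exprn_gt0 // mul1r ler_pXn2r ?nnegrE ?(ltW e0) // ltW.
Qed.

Lemma score_limits_of_decay : score_limits S P X xi.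
Proof.
have [s [sE sP]] := variance_cvg_real.
have Y1E : (fun t => xi 1%g (X t)) = Y None 1%g.
  by apply/funext => t; rewrite wscoreNone.
have iY1 := square_integ_integ (@Y_sq None 1%g I).
have mean_cvg : (w n)%:R^-1 * \sum_(x <- B n) Ex P (Y (Some n) x) @[n --> \oo] --> m.
  apply: (@average_cvg _ _ (K + `|m|)) => [n x n0 xn|e e0].
    apply: le_trans (ler_normB _ _) _; rewrite lerD2r.
    by apply: Ex_bound => //; exact/windowP.
  have [r rP] := Ex_window e0; exists r => n x n0 dx.
  by rewrite /m -(Ex_stat x); exact: rP.
have s0 : 0 <= s.
  apply/ler_addgt0Pr => e e0; have [N NP] := (cvg_seqP _ _).1 sP e e0.
  have := NP (maxn N 1) (leq_maxl _ _).
  rewrite -Cv_H ?leq_max ?orbT //.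
  have := Cv_ge0 (@H_sq (maxn N 1) _); rewrite leq_max orbT => /(_ isT) C0.
  have : 0 <= (w (maxn N 1))%:R^-1 * Cv P (H (maxn N 1)) (H (maxn N 1)).
    by rewrite mulr_ge0 // invr_ge0.
  by rewrite ler_norml => ? /andP[]; lra.
split.
- by rewrite score_covE; exact: summable_real f_sum.
- by rewrite sE lee_fin s0 ltry.
- rewrite sE; apply: cvg_EFin_from1 sP => n n0.
  by rewrite volE // /variance covE ?Cv_H //; exact: H_sq.
- by rewrite Y1E.
- rewrite Y1E expectationE //= => e e0.
  pose h n t := (w n)%:R^-1 * H n t.
  pose a n : R := (w n)%:R^-1.
  pose b n := (w n)%:R^-1 * \sum_(x <- B n) row n x.
  pose c n := (w n)%:R^-1 * \sum_(x <- B n) Ex P (Y (Some n) x).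
  have a0 : a n @[n --> \oo] --> (0 : R).
    apply/cvg_seqP => e1 e10; have [N NP] := vol_unbounded e1^-1.
    exists N => n /NP h1; rewrite subr0 /a ger0_norm ?invr_ge0 //.
    by rewrite -[leRHS]invrK lef_pV2 // posrE ?invr_gt0 // (lt_le_trans _ h1) // invr_gt0.
  (* For n >= 1 the variance of H_n / w_n is [a n * b n], where a tends to 0 and b to s; [c n - m]
     is the bias. *)
  have q0 : e ^- 2 * (a n * b n + (c n - m) * (c n - m)) @[n --> \oo] --> (0 : R).
    rewrite [X in _ --> X](_ : 0 = e ^- 2 * (0 * s + (m - m) * (m - m))); last by ring.
    have cm : c n - m @[n --> \oo] --> m - m by apply: cvgB => //; exact: cvg_cst.
    by apply: cvgM; [exact: cvg_cst|apply: cvgD; apply: cvgM].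
  have sh n : (0 < n)%N -> square_integ P (h n).
    move=> n0; have := square_integM (H_sq n0) (H_sq n0) => i2.
    split; first by apply: measurable_funM => //; case: (H_sq n0).
    apply: eq_integrable (integZ ((w n)%:R^-1 ^+ 2) i2) => // t _ /=.
    by rewrite /h; congr EFin; ring.
  have Exh n : (0 < n)%N -> Ex P (h n) = c n.
    by move=> n0; rewrite /h ExZ ?Ex_H //; exact/square_integ_integ/H_sq.
  have Cvh n : (0 < n)%N -> Cv P (h n) (h n) = a n * b n.
    move=> n0; rewrite /h Cv_cst_mul; [|exact: H_sq|exact: sh].
    rewrite CvC Cv_cst_mul; [|exact: H_sq|exact: H_sq].
    by rewrite Cv_H.
  apply: (@squeeze_cvge _ _ _ _ (cst 0%E) _ (fun n =>
      (e ^- 2 * (a n * b n + (c n - m) * (c n - m)))%:E)).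
  + exists 1%N => // n /= n0; rewrite measure_ge0 /=.
    by have := chebyshev_real m e0 (sh n n0); rewrite Exh // Cvh // /h volE.
  + exact: cvg_cst.
  + exact: cvg_EFin_from1 q0.
Qed.

End limit.

(** * The theorem under a covariance decay condition *)

Section criterion.
Context (V : groupType) (S : set V) d (T : measurableType d) (R : realType)
  (P : probability T R) (X : T -> config V) (xi : V -> set V -> R).
Hypothesis S_gen : cayley_generators S.
Hypothesis V_infinite : infinite_set [set: V].
Hypothesis xi_score : score_function xi.
Hypothesis mX : measurable_fun setT X.
Hypothesis amenable : b_amenable R S.
Variables (C c : nat -> R) (phi : R -> R).
Hypothesis clX : clustering S P X C c phi.

(** Each distance s chooses how its covariances are bounded: by [Cv_crude], the source of K + K * K,
    or by truncation at some radius r, whose cost (2 + 2 * K) * tau r comes from [Cv_cut]. The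
    majorant G has to dominate only the chosen bound. *)
Lemma score_limits_criterion (K Gam : R) (tau M G : nat -> R) :
  (forall n x, window_index n -> square_integ P (wscore S X xi n x)) ->
  (forall n x, window_index n -> window R S n x ->
    mass_on P (wscore S X xi n x) setT <= K) ->
  (forall n r x y, window_index n -> window R S n x -> window R S n y ->
    mass_on P (wscore S X xi n x) (unstable S X xi n r y) <= tau r) ->
  (forall r mu, `|xi 1%g (mu `&` gball S 1%g (r%:R : R))| <= M r) ->
  (forall e, 0 < e -> exists r, tau r <= e) ->
  (forall s, 0 <= G s) ->
  (forall F : {fset V}, \sum_(z <- F) G (glen S z) <= Gam) ->
  (forall s, K + K * K <= G s \/ exists2 r, (2 * r < s)%N &
    (2 + 2 * K) * tau r + cluster_bound S C c phi M r (s - 2 * r) <= G s) ->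
  score_limits S P X xi.
Proof.
move=> sq mass tauP MP tau0 G0 Gsum GP.
have K0 : 0 <= K := le_trans (mass_on_ge0 _ _ _) (@mass None 1%g I I).
apply: (@score_limits_of_decay _ _ _ _ _ _ _ _ S_gen V_infinite xi_score amenable G Gam K
  sq G0 Gsum).
- move=> n x y ni nx ny; have [h|[r rs h]] := GP (gdist S x y).
    by apply: le_trans h; apply: Cv_crude; [exact: sq|exact: sq|exact: mass|exact: mass].
  apply: le_trans h.
  exact: (wscore_Cv_decay S_gen xi_score mX clX sq mass tauP MP).
- move=> e e0; have [|r rP] := tau0 (e / (2 * (2 + 2 * K))).
    by rewrite divr_gt0 //; lra.
  exists r => n x y n0 dx dy.
  apply: le_trans (wscore_Cv_window S_gen xi_score mX sq mass tauP n0 dx dy) _.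
  by move: rP; rewrite ler_pdivlMr; lra.
- move=> n x ni nx; apply: le_trans (mass n x ni nx).
  by apply: Ex_le_mass; exact: sq.
- move=> e e0; have [|r rP] := tau0 (e / 2); first by rewrite divr_gt0.
  exists r => n x n0 dx.
  apply: le_trans (wscore_Ex_window S_gen xi_score mX sq tauP n0 dx) _.
  by lra.
- exact: (wscore_Cv_stationary xi_score mX clX sq).
- exact: (wscore_Ex_stationary xi_score mX clX sq).
Qed.

End criterion.

(** A function of finitely many spins takes finitely many values; the induction fixes the spin of
    one site as 0 or 1. *)
Lemma local_bounded (V : groupType) (R : realType) (us : seq V) (f : set V -> R) :
  local_on us f -> exists M, forall mu, `|f mu| <= M.
Proof.
elim: us f => [|u us IH] f lf.
  by exists `|f set0| => mu; rewrite (local_nil mu lf).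
have [|M1 M1P] := IH (fun mu => f (mu `\` [set u])).
  move=> mu mu' h; apply: lf => v; rewrite inE => /predU1P[->|/h hv] /=.
    by split => -[].
  by rewrite /setD /= hv.
have [|M2 M2P] := IH (fun mu => f (mu `|` [set u])).
  move=> mu mu' h; apply: lf => v; rewrite inE => /predU1P[->|/h hv] /=.
    by split; right.
  by rewrite /setU /= hv.
exists (Num.max M1 M2) => mu; rewrite le_max; have [mu_u|mu_u] := pselect (mu u).
  apply/orP; right; apply: le_trans (M2P mu); rewrite le_eqVlt; apply/orP; left.
  apply/eqP; congr `|_|; apply: lf => v _ /=.
  by split => [|[//|->//]]; left.
apply/orP; left; apply: le_trans (M1P mu); rewrite le_eqVlt; apply/orP; left.
apply/eqP; congr `|_|; apply: lf => v _ /=; split => [mv|[]//].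
by split => // vu; apply: mu_u; rewrite -vu.
Qed.

(** * Local scores on amenable graphs *)

Section local_case.
Context (V : groupType) (S : set V) d (T : measurableType d) (R : realType)
  (P : probability T R) (X : T -> config V) (xi : V -> set V -> R).
Hypothesis S_gen : cayley_generators S.
Hypothesis V_infinite : infinite_set [set: V].
Hypothesis xi_score : score_function xi.
Hypothesis mX : measurable_fun setT X.

Lemma local_score_stab : local_score S xi ->
  exists2 r0, (0 < r0)%N & forall r x mu, (r0 <= r)%N -> stab_at S xi r x mu.
Proof.
move=> [r [r_gt0 rP]]; exists (Num.truncn r).+1 => // r' x mu rr' mu' h; apply: rP.
have sub : gball S 1%g r `<=` gball S 1%g (r'%:R : R).
  move=> y; rewrite /gball /= => /le_trans; apply.
  by apply: le_trans (ltW (truncnS_gt r)) _; rewrite ler_nat.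
have e (nu : set V) : nu `&` gball S 1%g r = nu `&` gball S 1%g (r'%:R : R) `&` gball S 1%g r.
  by rewrite -setIA (setIidr sub).
by rewrite e [RHS]e h.
Qed.

Lemma score_limits_local (C c : nat -> R) (phi : R -> R) :
  b_amenable R S -> clustering S P X C c phi -> summable_in S phi ->
  local_score S xi ->
  score_limits S P X xi.
Proof.
move=> am clX sumphi /local_score_stab[r0 r0_gt0 st].
have [_ [C0 _] [c0 _] [phi01 phi_le _] _] := clX.
have [M MP] : exists M, forall mu, `|xi 1%g mu| <= M.
  apply: (@local_bounded _ _ (ball_seq S 1%g r0)) => mu mu' h.
  by case: (stab_agree S_gen xi_score h (st r0 1%g mu (leqnn _))).
have xiM x mu : `|xi x mu| <= M by rewrite (score_at1 xi_score).
pose K := 1 + M ^+ 2.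
have sq n x : window_index n -> square_integ P (wscore S X xi n x).
  move=> _; apply: (@square_integ_bounded _ _ _ _ M) => [|w]; last exact: xiM.
  exact: measurable_wscore.
have massK n x D : measurable D -> mass_on P (wscore S X xi n x) D <= K.
  move=> mD; rewrite -[leRHS](Ex_cst P).
  have si : square_integ P (wscore S X xi n x).
    apply: (@square_integ_bounded _ _ _ _ M) => [|w]; last exact: xiM.
    exact: measurable_wscore.
  apply: Ex_le => [||w]; [exact: integ_mass|exact: integ_cst|].
  have h : 0 <= 1 + wscore S X xi n x w ^+ 2 <= K.
    rewrite addr_ge0 ?sqr_ge0 //= lerD2l -real_normK ?num_real // ler_pXn2r ?nnegrE ?xiM //.
    exact: le_trans (normr_ge0 _) (xiM x set0).
  case/andP: h => h0 h1.
  by rewrite indicE; case: (_ \in _); rewrite ?mulr1 // mulr0 (le_trans h0).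
(* From radius r0 on truncation is exact, as no score is unstable; below r0 only the crude mass
   bound K is available. *)
pose tau r := if (r0 <= r)%N then 0 else K.
pose k := (#|` ball_fset S r0| + #|` ball_fset S r0|)%N.
pose A := 3 ^+ #|` ball_fset S r0| * M * (3 ^+ #|` ball_fset S r0| * M * C k).
have M0 : 0 <= M := le_trans (normr_ge0 _) (MP set0).
have A0 : 0 <= A.
  by rewrite /A !mulr_ge0 // ?exprn_ge0 // ltW.
have K0 : 0 <= K by rewrite addr_ge0 // sqr_ge0.
(* Beyond 4 r0 the gap s - 2 r0 between the two balls is at least s / 2, whence the argument c_k s /
   2; up to 4 r0, at finitely many points, the crude bound is added. *)
pose G s := A * phi (c k / 2 * s%:R) + (K + K * K) * (s <= 4 * r0)%N%:R.
have phi0 s : 0 <= phi (c k / 2 * s%:R).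
  by case/andP: (phi01 (c k / 2 * s%:R) (mulr_ge0 (divr_ge0 (ltW (c0 _)) (ler0n
    _ _)) (ler0n _ _))).
have KK0 : 0 <= K + K * K by rewrite addr_ge0 // mulr_ge0.
have := sumphi (c k / 2) 1 _ (lexx _); rewrite divr_gt0 // => /(_ isT) sumlt.
pose Phi := fine (\esum_(x in [set: V]) (phi (c k / 2 * (glen S x)%:R) `^ 1^-1)%:E)%E.
have PhiP (F : {fset V}) : \sum_(z <- F) phi (c k / 2 * (glen S z)%:R) <= Phi.
  rewrite -lee_fin fineK; last first.
    rewrite fin_numElt sumlt andbT (lt_le_trans _ (esum_ge0 _)) ?ltNyr //.
    by move=> z _; rewrite lee_fin powR_ge0.
  apply: ereal_sup_ubound; exists [set` F]; first by split.
  rewrite fsbig_finite // set_fsetK sumEFin; congr EFin; apply: eq_bigr => z _.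
  by rewrite invr1 powRr1.
apply: (@score_limits_criterion _ _ _ _ _ _ _ _ S_gen V_infinite xi_score mX am C c phi clX
  K (A * Phi + (K + K * K) * (#|` ball_fset S (4 * r0)|)%:R) tau (fun=> M) G sq).
- by move=> n x _ _; apply: massK.
- move=> n r x y _ _ _; rewrite /tau; case: ifP => r0r; last first.
    by apply: massK; exact: measurable_unstable.
  rewrite (_ : unstable S X xi n r y = set0).
    rewrite /mass_on -[leRHS](Ex_cst P) le_eqVlt; apply/orP; left; apply/eqP/eq_Ex => w.
    by rewrite indicE in_set0 mulr0.
  by apply/seteqP; split => // w; apply; exact: st.
- by move=> r mu; exact: MP.
- by move=> e e0; exists r0; rewrite /tau leqnn ltW.
- by move=> s; rewrite addr_ge0 // mulr_ge0.
- move=> F; rewrite big_split /= -!mulr_sumr lerD //.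
    by rewrite ler_wpM2l.
  rewrite ler_wpM2l // -natr_sum ler_nat.
  rewrite (eq_bigr (fun z => if (glen S z <= 4 * r0)%N then 1 else 0)%N); last first.
    by move=> z _; case: leqP.
  rewrite -big_mkcond sum1_count -size_filter; apply: uniq_leq_size.
    by rewrite filter_uniq // fset_uniq.
  by move=> z; rewrite mem_filter in_ball_fset // => /andP[].
- move=> s; case: (leqP s (4 * r0)) => sr.
    left; rewrite /G sr mulr1 lerDr; exact: mulr_ge0.
  right; exists r0; first lia.
  rewrite /tau leqnn mulr0 add0r /G leqNgt sr /= mulr0 addr0 /cluster_bound -/k.
  rewrite /A !mulrA ler_wpM2l //.
    by rewrite !mulr_ge0 // ?exprn_ge0 // ltW.
  apply: phi_le; first by rewrite mulr_ge0 // divr_ge0 // ltW.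
  rewrite -mulrA ler_wpM2l ?(ltW (c0 _)) //.
  have : (s <= 2 * (s - 2 * r0))%N by lia.
  by rewrite -(ler_nat R) natrM; lra.
Qed.

End local_case.

(** * Stretched exponential estimates *)

Section asymptotics.
Variable R : realType.

Lemma stretched_exp_decayP (f : R -> R) (b : R) : stretched_exp_decay f b ->
  exists e t0 : R, 0 < e /\ forall t, t0 <= t -> f t <= expR (- (e * t `^ b)).
Proof.
rewrite /stretched_exp_decay => /ereal_inf_lt[_ [W [M [_ MW]] <-]] supW.
set g := fun t : R => _ in supW.
(* The supremum may be -oo, for instance when f vanishes far out; any rate then serves, and 1 is
   taken. *)
have [e e0 supe] : exists2 e : R, 0 < e & (ereal_sup (g @` W) <= (- e)%:E)%E.
  move: supW; case: (ereal_sup _) => [r| |] //.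
    by rewrite lte_fin => r0; exists (- r); rewrite ?oppr_gt0 // opprK.
  by exists 1; rewrite ?ltr01 // leNye.
(* M + 1 since a neighbourhood of +oo contains only the t strictly above M, and 1 so that t^b is
   positive. *)
exists e, (Num.max (M + 1) 1); split => // t; rewrite ge_max => /andP[Mt t1].
have tb : 0 < t `^ b by rewrite powR_gt0 // (lt_le_trans ltr01).
have gt : (g t <= (- e)%:E)%E.
  apply: le_trans supe; apply: ereal_sup_ubound; exists t => //.
  by apply: MW; lra.
have [ft|ft] := lerP (f t) 0; first by apply: (le_trans ft); exact: expR_ge0.
move: gt; rewrite /g lne_EFin // -EFinM lee_fin ler_pdivrMr // mulNr => h.
by rewrite -[leLHS]lnK ?posrE // ler_expR.
Qed.

(** For k >= N / c, the single term x^k / k! of the exponential series at x = e r^c already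
    dominates a multiple of r^N. The factor 2^N comes from r + 1 <= 2 r. *)
Lemma polynomial_times_exp (e c : R) N : 0 < e -> 0 < c ->
  exists2 B : R, 0 < B & forall r : nat, (0 < r)%N ->
    (r.+1)%:R ^+ N * expR (- (e * r%:R `^ c)) <= B.
Proof.
move=> e0 c0; pose k := (Num.truncn (N%:R / c)).+1.
have ck : N%:R <= c * k%:R.
  by rewrite mulrC -ler_pdivrMr // ltW // truncnS_gt.
have ek : 0 < e ^+ k / k`!%:R by rewrite divr_gt0 ?exprn_gt0 // ltr0n fact_gt0.
exists (2 ^+ N / (e ^+ k / k`!%:R)) => [|r r0]; first by rewrite divr_gt0 ?exprn_gt0.
have r1 : 1 <= r%:R :> R by rewrite ler1n.
rewrite expRN ler_pdivrMr ?expR_gt0 //.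
have h1 : e ^+ k / k`!%:R * r%:R ^+ N <= expR (e * r%:R `^ c).
  have x0 : 0 <= e * r%:R `^ c by rewrite mulr_ge0 ?powR_ge0 // ltW.
  have := expR_ge1Dxn (Num.truncn (N%:R / c)) x0; rewrite -/k => h.
  have {}h : (e * r%:R `^ c) ^+ k / k`!%:R <= expR (e * r%:R `^ c).
    by apply: le_trans h; rewrite lerDr.
  apply: le_trans h; rewrite exprMn [leRHS]mulrAC ler_wpM2l ?(ltW ek) //.
  rewrite -[X in _ <= X]powR_mulrn ?powR_ge0 // -powRrM -powR_mulrn ?ler0n //.
  exact: ler_powR.
rewrite mulrAC ler_pdivlMr //.
apply: le_trans (ler_wpM2l (exprn_ge0 N (ler0n _ 2)) h1).
have h2 : (r.+1)%:R ^+ N <= 2 ^+ N * r%:R ^+ N :> R.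
  by rewrite -exprMn; apply: lerXn2r; rewrite ?nnegrE ?mulr_ge0 ?ler0n // -natrM ler_nat; lia.
by rewrite [leLHS]mulrC [leRHS]mulrCA ler_wpM2l // ltW.
Qed.

Lemma nat_root q s : (0 < q)%N -> exists r, (r ^ q <= s < r.+1 ^ q)%N.
Proof.
move=> q0; elim: s => [|s [r /andP[rs sr]]]; first by exists 0%N; rewrite exp0n // exp1n.
case: (leqP (r.+1 ^ q) s.+1) => h.
  by exists r.+1; rewrite h /= (leq_ltn_trans sr) // ltn_exp2r.
by exists r; rewrite h andbT ltnW.
Qed.

Lemma sum_inverse_squares J : \sum_(0 <= j < J) (j.+1)%:R ^- 2 <= 2 :> R.
Proof.
(* The stronger bound 2 - 1 / (k + 1) makes the induction telescope. *)
suff h k : \sum_(0 <= j < k.+1) (j.+1)%:R ^- 2 <= 2 - (k.+1)%:R^-1 :> R.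
  case: J => [|k]; first by rewrite big_nil.
  by apply: le_trans (h k) _; rewrite gerBl invr_ge0.
elim: k => [|k IH]; first by rewrite big_nat1 expr1n invr1; lra.
rewrite big_nat_recr //=; apply: le_trans (lerD IH (lexx _)) _.
have a0 : 0 < k.+1%:R :> R by rewrite ltr0n.
have -> : k.+2%:R = k.+1%:R + 1 :> R by rewrite -natr1.
move: (k.+1%:R) a0 => a a0.
rewrite -subr_ge0 (_ : _ - _ = (a * (a + 1) ^+ 2)^-1); last by field; lra.
by rewrite invr_ge0 mulr_ge0 ?exprn_ge0 //; lra.
Qed.

Lemma sum_by_levels (K : choiceType) (F : {fset K}) (h : K -> nat) (g : nat -> R)
    (N : nat -> nat) :
  (forall j, 0 <= g j) -> (forall j, count (fun z => h z == j) F <= N j)%N ->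
  exists J, \sum_(z <- F) g (h z) <= \sum_(0 <= j < J) (N j)%:R * g j.
Proof.
move=> g0 cN; exists (\max_(z <- F) h z).+1%N.
set J := (\max_(z <- F) h z).+1%N.
have hJ z : z \in F -> (h z < J)%N by move=> zF; rewrite ltnS leq_bigmax_seq.
rewrite big_seq (eq_bigr (fun z => \sum_(0 <= j < J) (h z == j)%:R * g j)); last first.
  move=> z zF; rewrite (bigD1_seq (h z)) ?iota_uniq ?mem_index_iota ?hJ //=.
  rewrite eqxx mul1r big1 ?addr0 // => j; rewrite eq_sym => /negPf ->.
  by rewrite mul0r.
rewrite -big_seq exchange_big /=; apply: ler_sum => j _.
rewrite -mulr_suml ler_wpM2r // -natr_sum ler_nat; apply: leq_trans (cN j).
rewrite (eq_bigr (fun z => if h z == j then 1 else 0)%N); last by move=> z _; case: eqP.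
by rewrite -big_mkcond sum1_count.
Qed.

End asymptotics.

(** * Exponentially quasi-local scores *)

Section quasi_local.
Context (V : groupType) (S : set V) d (T : measurableType d) (R : realType)
  (P : probability T R) (X : T -> config V) (xi : V -> set V -> R).
Hypothesis S_gen : cayley_generators S.
Hypothesis xi_score : score_function xi.
Hypothesis mX : measurable_fun setT X.

Local Notation Y := (wscore S X xi).

Lemma sup_windows_le (F : option nat -> V -> \bar R) (v : \bar R) n x :
  (sup_windows S F <= v)%E -> window_index n -> window R S n x -> (F n x <= v)%E.
Proof.
move=> Fv ni nx; apply: le_trans Fv; rewrite /sup_windows.
apply: (@le_trans _ _ (ereal_sup [set F n x | x in window R S n])).
  by apply: ereal_sup_ubound; exists x.
by apply: ereal_sup_ubound; exists n.
Qed.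

Lemma stab_mono r r' mu : (r <= r')%N -> stab S xi r mu -> stab S xi r' mu.
Proof.
move=> rr' st mu' h; apply: st.
have sub : gball S 1%g (r%:R : R) `<=` gball S 1%g (r'%:R : R).
  by rewrite !gball_nat => y /= /leq_trans; apply.
have e (nu : set V) : nu `&` gball S 1%g (r%:R : R) =
    nu `&` gball S 1%g (r'%:R : R) `&` gball S 1%g (r%:R : R).
  by rewrite -setIA (setIidr sub).
by rewrite e h -e.
Qed.

(** Radii of stabilisation are positive integers or +oo, so failing to stabilise at r >= 1 means
    having radius at least r + 1. *)
Lemma unstableE n r x : (0 < r)%N -> unstable S X xi n r x =
  [set w | ((r.+1)%:R%:E <= stab_radius S xi x (restrict_spin R S X n w))%E].
Proof.
move=> r0; apply/seteqP; split => w /=; rewrite /unstable /stab_radius /stab_radius0 /=.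
  move=> nst; apply: le_ereal_inf_tmp => _ [r' [r'0 st] <-].
  rewrite lee_fin ler_nat ltnNge; apply/negP => r'r; apply: nst.
  exact: stab_mono r'r st.
move=> h st.
have : (ereal_inf [set (r%:R : R)%:E | r in [set r : nat | (0 < r)%N /\
    stab S xi r (translate x^-1%g (restrict_spin R S X n w))]] <= (r%:R)%:E)%E.
  by apply: ereal_inf_lbound; exists r.
by move/(le_trans h); rewrite lee_fin ler_nat ltnn.
Qed.

Lemma unstable_decay : exp_quasi_local S P X xi ->
  exists A e c : R, exists R1 : nat, [/\ 0 < A, 0 < e, 0 < c, (0 < R1)%N &
    forall n r x, window_index n -> window R S n x -> (R1 <= r)%N ->
      fine (P (unstable S X xi n r x)) <= A * expR (- (e * r%:R `^ c))].
Proof.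
move=> [A [f [A0 [_ _] fP [c [c0 /stretched_exp_decayP[e [t0 [e0 et]]]]]]]].
exists A, e, c, (Num.truncn t0).+1; split => // n r x ni nx Rr.
have r0 : (0 < r)%N by exact: leq_trans Rr.
have := sup_windows_le (fP (r.+1)%:R (ler0n _ _)) ni nx.
rewrite -unstableE // => h; rewrite -lee_fin fineK; last first.
  by apply: fin_num_measure; exact: measurable_unstable.
apply: (le_trans h); rewrite lee_fin ler_pM2l //.
have h1 : t0 <= (r.+1)%:R.
  by apply: le_trans (ltW (truncnS_gt t0)) _; rewrite ler_nat ltnW.
apply: le_trans (et _ h1) _; rewrite ler_expR lerN2 ler_pM2l //.
by apply: ge0_ler_powR; rewrite ?nnegrE ?ler0n ?ler_nat // ltW.
Qed.

Definition cap n x w : R := Num.max `|Y n x w| 1.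

Section moments.
Variable p : R.
Hypothesis p_gt2 : 2 < p.

Lemma measurable_cap_powR n x : measurable_fun setT (fun w => cap n x w `^ p).
Proof.
apply: (measurableT_comp (measurable_powR p)).
by apply: measurable_maxr => //; apply: measurableT_comp => //; exact: measurable_wscore.
Qed.

Lemma moment_bound : moment_condition S P X xi p ->
  exists2 K : R, 0 < K & forall n x, window_index n -> window R S n x ->
    integ P (fun w => cap n x w `^ p) /\ Ex P (fun w => cap n x w `^ p) <= K.
Proof.
rewrite /moment_condition; set s := sup_windows _ _ => slt.
have s_fin n x : window_index n -> window R S n x ->
    ('E_P[fun w => (cap n x w `^ p)%R] <= s)%E.
  by move=> ni nx; exact: (sup_windows_le (lexx s)).
exists (`|fine s| + 1) => [|n x ni nx]; first by rewrite ltr_wpDl.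
have h := s_fin n x ni nx.
have ip : integ P (fun w => cap n x w `^ p).
  apply/integrableP; split; first by apply/measurable_EFinP; exact: measurable_cap_powR.
  apply: le_lt_trans slt; apply: le_trans h; rewrite unlock le_eqVlt.
  apply/orP; left; apply/eqP; apply: eq_integral => w _ /=.
  by rewrite ger0_norm // powR_ge0.
split => //; rewrite expectationE // in h.
have sfin : s \is a fin_num by rewrite fin_numElt slt andbT (lt_le_trans _ h) // ltNyr.
move: h; rewrite -(fineK sfin) lee_fin => h.
by apply: (le_trans h); rewrite (le_trans (ler_norm _)) // lerDl.
Qed.

Lemma cap_ge1 n x w : 1 <= cap n x w.
Proof. by rewrite /cap le_max lexx orbT. Qed.

Lemma sqr_le_cap n x w : 1 + Y n x w ^+ 2 <= 2 * cap n x w ^+ 2.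
Proof.
have h1 : 1 <= cap n x w ^+ 2 by rewrite exprn_ege1 // cap_ge1.
have h2 : Y n x w ^+ 2 <= cap n x w ^+ 2.
  rewrite -real_normK ?num_real //; apply: lerXn2r; rewrite ?nnegrE //.
    by rewrite (le_trans ler01) // cap_ge1.
  by rewrite /cap le_max lexx.
lra.
Qed.

Lemma cap_sqr_le n x w : cap n x w ^+ 2 <= cap n x w `^ p.
Proof.
rewrite -powR_mulrn ?(le_trans ler01 (cap_ge1 _ _ _)) //.
by apply: ler_powR; [exact: cap_ge1|exact: ltW].
Qed.

Lemma square_integ_wscore n x : moment_condition S P X xi p ->
  window_index n -> square_integ P (Y n x).
Proof.
(* The moment condition speaks of points of the window; at the others the score is 0. *)
move=> /moment_bound[K K0 KP] ni; have [nx|nx] := pselect (window R S n x); last first.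
  apply: (@square_integ_bounded _ _ _ _ 0) => [|w]; first exact: measurable_wscore.
  by rewrite wscore_out // normr0.
have [ip _] := KP n x ni nx; split; first exact: measurable_wscore.
apply: (integ_dom _ (integZ 2 ip)).
  by apply: measurable_funX; exact: measurable_wscore.
move=> w; rewrite ger0_norm ?sqr_ge0 //.
have := sqr_le_cap n x w; have := cap_sqr_le n x w; lra.
Qed.

(* Where the score exceeds M one uses cap^2 <= M^(2-p) cap^p. *)
Lemma mass_on_moment (K M : R) n x D : measurable D -> 1 <= M ->
  square_integ P (Y n x) ->
  integ P (fun w => cap n x w `^ p) -> Ex P (fun w => cap n x w `^ p) <= K ->
  mass_on P (Y n x) D <= 2 * (M ^+ 2 * fine (P D) + M `^ (2 - p) * K).
Proof.
move=> mD M1 sq ip iK; have M0 : 0 < M by exact: lt_le_trans M1.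
apply: (@le_trans _ _ (2 * (M ^+ 2 * Ex P \1_D + M `^ (2 - p) * Ex P (fun w =>
  cap n x w `^ p)))); last first.
  by rewrite Ex_indic // ler_pM2l // lerD2l ler_wpM2l ?powR_ge0.
have i1 := integZ (M ^+ 2) (integ_indic P mD); have i2 := integZ (M `^ (2 - p)) ip.
rewrite -(ExZ (M ^+ 2) (integ_indic P mD)) -(ExZ _ ip) -ExD //.
rewrite -ExZ; last exact: integD.
apply: Ex_le; [exact: integ_mass|by apply: integZ; exact: integD|move=> w].
have U1 := cap_ge1 n x w; have U0 : 0 < cap n x w by exact: lt_le_trans U1.
have Up0 : 0 <= M `^ (2 - p) * cap n x w `^ p by rewrite mulr_ge0 ?powR_ge0.
rewrite indicE; case: (_ \in _); rewrite ?mulr1 ?mulr0 ?add0r; last by lra.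
apply: le_trans (sqr_le_cap n x w) _; rewrite ler_pM2l //.
have [UM|MU] := lerP (cap n x w) M.
  have : cap n x w ^+ 2 <= M ^+ 2 by apply: lerXn2r; rewrite ?nnegrE //; exact: ltW.
  by lra.
have : cap n x w ^+ 2 <= M `^ (2 - p) * cap n x w `^ p.
  have -> : cap n x w ^+ 2 = cap n x w `^ (2 - p) * cap n x w `^ p.
    rewrite -powRD; last by rewrite lt0r_neq0 ?implybT.
    by rewrite subrK -powR_mulrn // ltW.
  rewrite ler_wpM2r ?powR_ge0 //.
  rewrite -(opprB p 2) !powRN lef_pV2 ?posrE ?powR_gt0 //.
  have p2 : 0 <= p - 2 by rewrite subr_ge0 ltW.
  by apply: (ge0_ler_powR p2); rewrite ?nnegrE; exact: ltW.
have := sqr_ge0 M; lra.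
Qed.

End moments.

End quasi_local.

(** * Truncation radius against clustering decay *)

Section exponential_case.
Context (V : groupType) (S : set V) d (T : measurableType d) (R : realType)
  (P : probability T R) (X : T -> config V) (xi : V -> set V -> R).
Hypothesis S_gen : cayley_generators S.
Hypothesis V_infinite : infinite_set [set: V].
Hypothesis xi_score : score_function xi.
Hypothesis mX : measurable_fun setT X.

Local Notation w n := (#|` ball_fset S n|).

(** The radius is enlarged to r + 1 because the growth condition asks for t > 0, and because
    rounding kappa up to an integer needs a base at least 1. *)
Lemma growth_bound : exponential_growth S xi -> exists L : R, exists kap : nat,
  0 <= L /\ forall (r : nat) (mu : set V),
    `|xi 1%g (mu `&` gball S 1%g (r%:R : R))| <= expR (L * (r.+1)%:R ^+ kap).
Proof.
move=> [kap [L [kap0 LP]]]; exists `|L|, (Num.truncn kap).+1; split => // r mu.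
have sub : gball S 1%g (r%:R : R) `<=` gball S 1%g ((r.+1)%:R : R).
  by rewrite !gball_nat => y /= /leqW.
rewrite -(setIidl sub) setIA; apply: le_trans (LP _ _ _) _; first by rewrite ltr0n.
rewrite ler_expR; apply: le_trans (ler_wpM2r (powR_ge0 _ _) (ler_norm L)) _.
rewrite ler_wpM2l // -powR_mulrn ?ler0n //; apply: ler_powR; first by rewrite ler1n.
exact/ltW/truncnS_gt.
Qed.

(** For large k, k^(a k) <= k^k = exp(k ln k) <= exp(k^2); the constant [C N.+1] covers the initial
    indices by monotonicity. *)
Lemma constants_bound (C : nat -> R) (a : R) : 0 <= a < 1 ->
  (forall k l, (k <= l)%N -> C k <= C l) -> (forall k, 0 < C k) ->
  C =O_\oo (fun k : nat => k%:R `^ (a * k%:R)) ->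
  exists2 A : R, 0 < A & forall k, C k <= A * expR (k%:R ^+ 2).
Proof.
move=> /andP[a0 a1] Cle C0 /eqO_bound[A [N [A0 AP]]].
exists (A + C N.+1) => [|k]; first by rewrite addr_gt0.
have e1 : 1 <= expR (k%:R ^+ 2) :> R by rewrite -[leLHS]expR0 ler_expR sqr_ge0.
have [Nk|kN] := leqP N.+1 k; last first.
  apply: (le_trans (Cle _ _ (ltnW kN))).
  have h : C N.+1 <= C N.+1 * expR (k%:R ^+ 2) by rewrite ler_peMr // ltW.
  by rewrite mulrDl (le_trans h) // lerDr mulr_ge0 ?expR_ge0 // ltW.
have := AP k (ltnW Nk); rewrite ger0_norm ?(ltW (C0 _)) // => /le_trans; apply.
have k1 : 1 <= k%:R :> R by rewrite ler1n (leq_trans _ Nk).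
have k0 : 0 < k%:R :> R by exact: lt_le_trans k1.
apply: (@le_trans _ _ (A * expR (k%:R ^+ 2))); last first.
  by rewrite ler_wpM2r ?expR_ge0 // lerDl ltW.
rewrite ler_pM2l // ger0_norm ?powR_ge0 //.
apply: (@le_trans _ _ (k%:R `^ k%:R)).
  by apply: ler_powR => //; rewrite ler_piMl // ltW.
rewrite -[X in X `^ _]lnK ?posrE // -expRM ler_expR expr2 ler_pM2r //.
have := ln_sublinear k0; exact: ltW.
Qed.

Variables (C0 D : nat).
Hypothesis vol_le : forall n, (0 < n)%N -> (w n <= C0 * n ^ D)%N.

(* The prefactors 3^w_r, M and C(2 w_r) are exp(O(r^N)), whereas r^q <= s with
   q b > N makes the clustering function at most exp(- const r^(N+1)). *)
Lemma cluster_decay (C c : nat -> R) (phi : R -> R) (L A c0 b : R) (kap : nat) :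
  0 <= L -> 0 < A -> 0 < c0 -> 0 < b -> fast_decreasing phi ->
  (forall k, 0 < C k) -> (forall k, C k <= A * expR (k%:R ^+ 2)) ->
  (forall k, c0 <= c k) -> stretched_exp_decay phi b ->
  exists q r1, [/\ (0 < q)%N, (0 < r1)%N & forall r s, (r1 <= r)%N -> (r ^ q <= s)%N ->
    (2 * r < s)%N /\
    cluster_bound S C c phi (fun r => expR (L * (r.+1)%:R ^+ kap)) r (s - 2 * r)
      <= A * expR (- (1 * r%:R `^ 1))].
Proof.
move=> L0 A0 c00 b0 [phi01 phi_le _] C_gt0 CA c0c /stretched_exp_decayP[e [t0 [e0 et]]].
(* N bounds the exponents D, 2 D and kap of the prefactors and is at least 1, so that r <= r^N. One
   successor in q rounds (N + 1) / b up; the other ensures q >= 2, so that r^2 <= s. *)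
pose N := (2 * D + kap).+1; pose q := (Num.truncn (N.+1%:R / b)).+2.
have qb : N.+1%:R <= q%:R * b.
  rewrite -ler_pdivrMr // (le_trans (ltW (truncnS_gt _))) // ler_nat /q //.
(* With k = w_r, the three terms come from the two factors 3^k <= exp(2k), from the two score
   bounds, and from (k + k)^2 in the bound on C. *)
pose B2 : R := 4 * C0%:R + 2 * L + 4 * C0%:R ^+ 2.
have B20 : 0 <= B2 by rewrite !addr_ge0 ?mulr_ge0 ?sqr_ge0.
pose e3 := e * (c0 / 2) `^ b.
have e30 : 0 < e3 by rewrite mulr_gt0 // powR_gt0 // divr_gt0.
(* The summands serve in turn to give 4 r < r^2 <= s, to bring the argument of phi above t0, and to
   let e3 r^(N+1) absorb B2 (r + 1)^N + r. *)
pose r1 := (5 + (Num.truncn (2 * t0 / c0)).+1 + (Num.truncn ((B2 * 2 ^+ N + 1) / e3)).+1)%N.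
exists q, r1; split => // r s r1r rqs.
have r5 : (5 <= r)%N by apply: leq_trans r1r; rewrite /r1 -addnA leq_addr.
have rt0 : 2 * t0 / c0 <= r%:R.
  apply: le_trans (ltW (truncnS_gt _)) _; rewrite ler_nat; apply: leq_trans r1r.
  by rewrite /r1 -addnA addnCA leq_addr.
have rB : (B2 * 2 ^+ N + 1) / e3 <= r%:R.
  apply: le_trans (ltW (truncnS_gt _)) _; rewrite ler_nat; apply: leq_trans r1r.
  by rewrite /r1 leq_addl.
have rq : (r ^ 2 <= r ^ q)%N by rewrite leq_exp2l // (leq_trans _ r5).
have s4r : (4 * r < s)%N.
  apply: leq_trans rqs; apply: leq_trans rq; rewrite -mulnn.
  by have := leq_mul r5 (leqnn r); clear -r5; lia.
split; first by clear -s4r; lia.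
have r_gt0 : (0 < r)%N by exact: leq_trans r5.
have r1' : 1 <= r%:R :> R by rewrite ler1n.
have r0 : 0 < r%:R :> R by exact: lt_le_trans r1'.
set s' := (s - 2 * r)%N.
have s'r : r%:R ^+ q / 2 <= s'%:R :> R.
  rewrite ler_pdivrMr // -(natrX R) -(natrM R) ler_nat; apply: leq_trans rqs _.
  by rewrite /s'; clear -s4r; lia.
set k := #|` ball_fset S r|.
have phis : phi (c (k + k)%N * s'%:R) <= expR (- (e3 * r%:R ^+ N.+1)).
  apply: le_trans (phi_le (c0 / 2 * r%:R ^+ q) _ _ _) _.
  - by rewrite mulr_ge0 ?exprn_ge0 // divr_ge0 // ltW.
  - apply: (@le_trans _ _ (c0 * s'%:R)); last by rewrite ler_wpM2r.
    by rewrite -mulrA ler_pM2l // mulrC.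
  apply: le_trans (et _ _) _.
    apply: (@le_trans _ _ (c0 / 2 * r%:R)).
      by move: rt0; rewrite ler_pdivrMr //; lra.
    rewrite ler_pM2l ?divr_gt0 //.
    by rewrite -[leLHS]expr1 ler_weXn2l.
  rewrite ler_expR lerN2 /e3 -mulrA ler_pM2l //
    [(c0 / 2 * _) `^ b]powRM ?exprn_ge0 ?divr_ge0 ?(ltW c00) //.
  rewrite ler_pM2l ?powR_gt0 ?divr_gt0 //.
  rewrite -(powR_mulrn q) ?(ltW r0) // -powRrM -powR_mulrn ?(ltW r0) //.
  exact: ler_powR.
have kle : k%:R <= C0%:R * (r.+1)%:R ^+ D :> R.
  apply: (@le_trans _ _ (C0%:R * r%:R ^+ D)).
    by rewrite -(natrX R) -(natrM R) ler_nat vol_le.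
  by rewrite ler_wpM2l //; apply: lerXn2r; rewrite ?nnegrE // ler_nat.
have ex3 : (3 : R) <= expR 2 by have := expR_ge1Dx (2 : R); lra.
have main_exp : 2 * k%:R + 2 * k%:R + 2 * (L * (r.+1)%:R ^+ kap) + (k + k)%:R ^+ 2
    <= B2 * (r.+1)%:R ^+ N :> R.
  have p1 : 1 <= (r.+1)%:R :> R by rewrite ler1n.
  have pw i : (i <= N)%N -> (r.+1)%:R ^+ i <= (r.+1)%:R ^+ N :> R.
    by move=> iN; rewrite ler_weXn2l.
  have h1 : k%:R <= C0%:R * (r.+1)%:R ^+ N :> R.
    by apply: le_trans kle _; rewrite ler_wpM2l // pw // /N; clear; lia.
  have h2 : L * (r.+1)%:R ^+ kap <= L * (r.+1)%:R ^+ N.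
    by rewrite ler_wpM2l // pw // /N; clear; lia.
  have h3 : k%:R ^+ 2 <= C0%:R ^+ 2 * (r.+1)%:R ^+ N :> R.
    apply: (@le_trans _ _ ((C0%:R * (r.+1)%:R ^+ D) ^+ 2)).
      by apply: lerXn2r; rewrite ?nnegrE // ?mulr_ge0 ?exprn_ge0.
    by rewrite exprMn -exprM ler_wpM2l ?sqr_ge0 // pw // /N; clear; lia.
  rewrite natrD (_ : (k%:R + k%:R) ^+ 2 = 4 * k%:R ^+ 2); last by ring.
  rewrite /B2; lra.
have exp_final : B2 * (r.+1)%:R ^+ N + r%:R <= e3 * r%:R ^+ N.+1.
  have h1 : (r.+1)%:R ^+ N <= 2 ^+ N * r%:R ^+ N :> R.
    by rewrite -exprMn; apply: lerXn2r; rewrite ?nnegrE ?mulr_ge0 ?ler0n //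
      -natrM ler_nat; clear -r_gt0; lia.
  have h2 : r%:R <= r%:R ^+ N :> R by rewrite -[leLHS]expr1 ler_weXn2l.
  have h3 : (B2 * 2 ^+ N + 1) * r%:R ^+ N <= e3 * r%:R ^+ N.+1.
    rewrite exprS mulrA ler_pM2r ?exprn_gt0 //.
    by move: rB; rewrite ler_pdivrMr // [r%:R * e3]mulrC.
  by apply: le_trans h3; rewrite [leRHS]mulrDl mul1r lerD // -mulrA ler_wpM2l.
rewrite mul1r powRr1 ?(ltW r0) // /cluster_bound -/k.
have phi0 : 0 <= phi (c (k + k)%N * s'%:R).
  have cs0 : 0 <= c (k + k)%N * s'%:R by rewrite mulr_ge0 // (le_trans (ltW c00)).
  by case/andP: (phi01 _ cs0).
have k3 : 3 ^+ k <= expR (2 * k%:R) :> R.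
  by rewrite mulrC expRM_natl; apply: lerXn2r; rewrite ?nnegrE ?expR_ge0.
set M := expR (L * _).
have M0 : 0 <= M := expR_ge0 _.
apply: (@le_trans _ _ (expR (2 * k%:R) * M * (expR (2 * k%:R) * M *
    (A * expR ((k + k)%:R ^+ 2) * expR (- (e3 * r%:R ^+ N.+1)))))).
  have a1 : 3 ^+ k * M <= expR (2 * k%:R) * M by rewrite ler_wpM2r.
  have a0 : 0 <= 3 ^+ k * M by rewrite mulr_ge0 // exprn_ge0.
  have c1 : C (k + k)%N * phi (c (k + k)%N * s'%:R) <=
      A * expR ((k + k)%:R ^+ 2) * expR (- (e3 * r%:R ^+ N.+1)).
    by rewrite ler_pM // ltW.
  have c2 : 0 <= C (k + k)%N * phi (c (k + k)%N * s'%:R) by rewrite mulr_ge0 // ltW.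
  by apply: ler_pM => //; [exact: mulr_ge0|exact: ler_pM].
have -> : expR (2 * k%:R) * M * (expR (2 * k%:R) * M *
    (A * expR ((k + k)%:R ^+ 2) * expR (- (e3 * r%:R ^+ N.+1)))) =
  A * expR (2 * k%:R + 2 * k%:R + 2 * (L * (r.+1)%:R ^+ kap) + (k + k)%:R ^+ 2
    + - (e3 * r%:R ^+ N.+1)).
  rewrite (_ : 2 * (L * (r.+1)%:R ^+ kap) = L * (r.+1)%:R ^+ kap + L *
    (r.+1)%:R ^+ kap); last by ring.
  by rewrite !expRD -/M; ring.
rewrite ler_pM2l // ler_expR lerBlDr [leRHS]addrC lerBrDr.
exact: le_trans (lerD main_exp (lexx _)) exp_final.
Qed.

End exponential_case.

(** * Quasi-local scores under polynomial growth *)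

Section exponential_theorem.
Context (V : groupType) (S : set V) d (T : measurableType d) (R : realType)
  (P : probability T R) (X : T -> config V) (xi : V -> set V -> R).
Hypothesis S_gen : cayley_generators S.
Hypothesis V_infinite : infinite_set [set: V].
Hypothesis xi_score : score_function xi.
Hypothesis mX : measurable_fun setT X.

Local Notation w n := (#|` ball_fset S n|).

(** The level where [rho] is j lies in the ball of radius (j + 1)^q, with at most C0 (j + 1)^(q D)
    points; the exponent q D + 2 leaves a sum of inverse squares. *)
Lemma root_decay_sum (C0 D q : nat) (rho : nat -> nat) (B : R) : 0 <= B ->
  (forall n, (0 < n)%N -> (w n <= C0 * n ^ D)%N) ->
  (forall s, (s < (rho s).+1 ^ q)%N) ->
  forall F : {fset V},
    \sum_(z <- F) B / (rho (glen S z)).+1%:R ^+ (q * D + 2) <= 2 * (C0%:R * B).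
Proof.
move=> B0 vol_le rhoP F.
pose g j : R := B / j.+1%:R ^+ (q * D + 2).
have [|j|J] := @sum_by_levels R V F (fun z => rho (glen S z)) g
    (fun j => C0 * j.+1 ^ (q * D))%N.
- by move=> j; rewrite divr_ge0 // exprn_ge0.
- apply: (@leq_trans (w (j.+1 ^ q))).
    rewrite -size_filter; apply: uniq_leq_size; first by rewrite filter_uniq // fset_uniq.
    move=> z; rewrite mem_filter => /andP[/eqP <- _].
    by rewrite in_ball_fset // ltnW.
  by apply: leq_trans (vol_le _ _) _; rewrite ?expn_gt0 // -expnM.
move=> /le_trans; apply.
rewrite (eq_bigr (fun j => C0%:R * B * (j.+1%:R ^- 2))); last first.
  move=> j _; rewrite natrM natrX /g exprD invfM.
  have h : j.+1%:R != 0 :> R by rewrite pnatr_eq0.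
  have h2 : (j.+1%:R ^+ (q * D) : R) != 0 by rewrite expf_neq0.
  by rewrite [RHS](_ : _ = C0%:R * B * (j.+1%:R ^- 2) * (j.+1%:R ^+ (q * D) /
    j.+1%:R ^+ (q * D))); [ring|rewrite mulfV // mulr1].
rewrite -mulr_sumr [leRHS]mulrC ler_wpM2l ?mulr_ge0 //.
exact: sum_inverse_squares.
Qed.

Lemma score_limits_exponential (p : R) :
  polynomial_growth R S -> exponentially_clustering S P X ->
  exp_quasi_local S P X xi -> exponential_growth S xi ->
  2 < p -> moment_condition S P X xi p ->
  score_limits S P X xi.
Proof.
move=> poly [C [c [phi [clX [c0 [c0_gt0 c0c]] [a [a01 CO]] [b [b0 phib]]]]]].
move=> /(unstable_decay S_gen xi_score mX)[A [e [g [R1 [A0 e0 g0 R10 unst]]]]].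
move=> /growth_bound[L [kap [L0 LP]]] p2 mom.
have [C0 [D vol_le]] := polynomial_growth_nat S_gen poly.
have [K0 K00 K0P] := moment_bound xi_score mX mom.
have [_ [C_gt0 Cle] _ phi_fast _] := clX.
have [CC CC0 CCP] := constants_bound a01 Cle C_gt0 CO.
have [q [r1 [q0 r10 clusP]]] :=
  cluster_decay vol_le kap L0 CC0 c0_gt0 b0 phi_fast C_gt0 CCP c0c phib.
pose m := (q * D + 2)%N.
(* With scores cut off at M = exp(e r^g / 4), M^2 times the bound A exp(-e r^g) on instability
   leaves the rate e / 2, and M^(2 - p) gives the rate (p - 2) e / 4. *)
pose ea := e / 2; pose eb := (p - 2) * e / 4.
have ea0 : 0 < ea by rewrite divr_gt0.
have eb0 : 0 < eb by rewrite divr_gt0 // mulr_gt0 // subr_gt0.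
pose E1 r : R := expR (- (ea * r%:R `^ g)).
pose E2 r : R := expR (- (eb * r%:R `^ g)).
(* Written with unit constants so that [polynomial_times_exp] applies to the bound of
   [cluster_decay] as well. *)
pose E3 r : R := expR (- (1 * r%:R `^ 1)).
have [B1 B10 B1P] := polynomial_times_exp m ea0 g0.
have [B2 B20 B2P] := polynomial_times_exp m eb0 g0.
have [B3 B30 B3P] := polynomial_times_exp m (ltr01 : 0 < (1 : R)) (ltr01 : 0 < (1 : R)).
(* The value of [mass_on_moment] at M = 1 on the whole space. *)
pose K := 2 * (1 + K0).
have K_ge0 : 0 <= K by rewrite mulr_ge0 // addr_ge0 // ltW.
pose tau r := if (R1 <= r)%N then 2 * (A * E1 r + E2 r * K0) else K.
have sq n x : window_index n -> square_integ P (wscore S X xi n x).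
  by move=> ni; apply: (square_integ_wscore xi_score mX p2).
have mass n x : window_index n -> window R S n x ->
    mass_on P (wscore S X xi n x) setT <= K.
  move=> ni nx; have [ip iK] := K0P n x ni nx.
  have := mass_on_moment p2 measurableT (lexx 1) (sq n x ni) ip iK.
  rewrite powR1 mul1r expr1n mul1r.
  have -> : fine (P setT) = 1 by rewrite -[RHS]/(fine 1%E); congr fine;
    exact: probability_setT.
  by [].
have tau_le r : (R1 <= r)%N -> tau r = 2 * (A * E1 r + E2 r * K0).
  by rewrite /tau => ->.
have tauP n r x y : window_index n -> window R S n x -> window R S n y ->
    mass_on P (wscore S X xi n x) (unstable S X xi n r y) <= tau r.
  move=> ni nx ny; have mU := measurable_unstable P S_gen xi_score mX n r y.
  case: (leqP R1 r) => Rr; last first.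
    rewrite /tau leqNgt Rr /=; apply: le_trans (mass n x ni nx).
    exact: mass_on_le (sq n x ni) mU.
  rewrite tau_le //; have [ip iK] := K0P n x ni nx.
  (* The cut-off level exp(e r^g / 4) makes both error terms stretched exponential. *)
  have M1 : 1 <= expR (e / 4 * r%:R `^ g).
    by rewrite -[leLHS]expR0 ler_expR mulr_ge0 ?powR_ge0 // divr_ge0 // ltW.
  apply: le_trans (mass_on_moment p2 mU M1 (sq n x ni) ip iK) _.
  rewrite ler_pM2l // lerD //; last first.
    rewrite -expRM /E2 le_eqVlt; apply/orP; left; apply/eqP; congr (expR _ * _).
    by rewrite /eb; field.
  apply: le_trans (ler_wpM2l (sqr_ge0 _) (unst n r y ni ny Rr)) _.
  rewrite mulrCA ler_pM2l // -expRM_natl -expRD ler_expR /ea.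
  by rewrite le_eqVlt; apply/orP; left; apply/eqP; field.
pose ro := maxn R1 r1.
pose Bt := (2 + 2 * K) * (2 * (A * B1 + B2 * K0)) + CC * B3.
have Bt0 : 0 <= Bt.
  by rewrite addr_ge0 // !(mulr_ge0, addr_ge0) // ltW.
(* Bt collects the constants of truncation and clustering for radii from [ro] on; the second summand
   lifts G above the crude bound at those s whose root [rho s] is smaller than [ro]. *)
pose B := Bt + (K + K * K) * (ro.+1)%:R ^+ m.
have KK0 : 0 <= K + K * K by rewrite addr_ge0 // mulr_ge0.
have B_ge0 : 0 <= B by rewrite addr_ge0 // mulr_ge0 // exprn_ge0.
have /choice[rho rhoP] s : exists r, (r ^ q <= s < r.+1 ^ q)%N by exact: nat_root.
pose G s : R := B / (rho s).+1%:R ^+ m.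
have E_le (E : nat -> R) Bi r : (0 < r)%N -> r.+1%:R ^+ m * E r <= Bi ->
    E r <= Bi / r.+1%:R ^+ m.
  by move=> _ h; rewrite ler_pdivlMr ?exprn_gt0 // mulrC.
apply: (@score_limits_criterion _ _ _ _ _ _ _ _ S_gen V_infinite xi_score mX
  (polynomial_growth_amenable S_gen poly) C c phi clX K (2 * (C0%:R * B)) tau
  (fun r => expR (L * r.+1%:R ^+ kap)) G sq mass tauP LP).
- move=> e1 e10; pose Bs := 2 * (A * B1 + B2 * K0).
  have Bs0 : 0 <= Bs by rewrite !(mulr_ge0, addr_ge0) // ltW.
  pose r := (R1 + (Num.truncn (Bs / e1)).+1)%N; exists r.
  have r0 : (0 < r)%N by rewrite /r addnS.
  have Rr : (R1 <= r)%N by rewrite leq_addr.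
  rewrite tau_le //; apply: (@le_trans _ _ (Bs / r.+1%:R ^+ m)).
    rewrite /Bs -mulrA ler_pM2l // mulrDl lerD //.
      by rewrite -mulrA ler_pM2l //; exact: E_le (B1P r r0).
    by rewrite mulrAC ler_pM2r //; exact: E_le (B2P r r0).
  rewrite ler_pdivrMr ?exprn_gt0 // mulrC -ler_pdivrMr //.
  apply: (@le_trans _ _ r.+1%:R).
    apply: le_trans (ltW (truncnS_gt _)) _; rewrite ler_nat.
    by apply: leqW; rewrite leq_addl.
  by rewrite -[leLHS]expr1 ler_weXn2l ?ler1n // /m addn2.
- by move=> s; rewrite divr_ge0 // exprn_ge0.
- by apply: root_decay_sum => // s; case/andP: (rhoP s).
- move=> s; have [/andP[rs _]] := rhoP s.
  have den0 : 0 < (rho s).+1%:R ^+ m :> R by rewrite exprn_gt0.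
  case: (leqP ro (rho s)) => ros; last first.
    left; rewrite /G ler_pdivlMr //; apply: (@le_trans _ _ ((K + K * K) * (ro.+1)%:R ^+ m)).
      by rewrite ler_wpM2l //; apply: lerXn2r; rewrite ?nnegrE // ler_nat ltnW.
    by rewrite /B lerDr.
  right; exists (rho s); move: ros; rewrite geq_max => /andP[Rr rr1].
    by have [] := clusP _ _ rr1 rs.
  have r0 : (0 < rho s)%N by exact: leq_trans Rr.
  apply: (@le_trans _ _ (Bt / (rho s).+1%:R ^+ m)); last first.
    by rewrite ler_pM2r ?invr_gt0 // lerDl mulr_ge0 // exprn_ge0.
  rewrite /Bt [leRHS]mulrDl lerD //.
    rewrite tau_le // -!mulrA ler_wpM2l //; first by rewrite addr_ge0 // mulr_ge0.
    rewrite ler_pM2l // mulrDl lerD //.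
      by rewrite -mulrA ler_pM2l //; exact: E_le (B1P _ r0).
    by rewrite mulrAC ler_pM2r //; exact: E_le (B2P _ r0).
  have [_ h] := clusP _ _ rr1 rs; apply: (le_trans h).
  by rewrite -mulrA ler_pM2l //; exact: (E_le E3 _ _ r0 (B3P _ r0)).
Qed.

End exponential_theorem.

Theorem theorem1p8 (R : realType) (V : groupType) (S : set V)
    (d : measure_display) (T : measurableType d) (P : probability T R)
    (X : {RV P >-> config V}) (xi : V -> set V -> R)
    (V_countable : countable [set: V]) (V_infinite : infinite_set [set: V])
    (S_gen : cayley_generators S)
    (xi_score : score_function xi)
    (conditions :
      [/\ b_amenable R S,
          exists (C c : nat -> R) (phi : R -> R),
            clustering S P X C c phi /\ summable_in S phi
        & local_score S xi]
      \/
      [/\ polynomial_growth R S,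
          exponentially_clustering S P X,
          exp_quasi_local S P X xi,
          exponential_growth S xi
        & exists p : R, 2 < p /\ moment_condition S P X xi p]) :
  [/\ summable [set: V] (score_cov P X xi),
      (0 <= sigma2 P X xi < +oo)%E,
      (((vol R S n)%:R^-1)%:E * 'V_P[score_sum S X xi n])%E @[n --> \oo]
        --> sigma2 P X xi,
      P.-integrable setT (EFin \o (fun w => xi 1%g (X w)))
    & cvg_in_probability P
        (fun n w => (vol R S n)%:R^-1 * score_sum S X xi n w)
        (fine 'E_P[fun w => xi 1%g (X w)])].
Proof.
have mX : measurable_fun setT (X : T -> config V) by exact: measurable_funPT.
case: conditions => [[am [C [c [phi [clX sphi]]]] loc]|[poly clX ql gr [p [p2 mom]]]].
  exact: (score_limits_local S_gen V_infinite xi_score mX am clX sphi loc).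
exact: (score_limits_exponential S_gen V_infinite xi_score mX poly clX ql gr p2 mom).
Qed.
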